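(* Let $\mathbb{K}$ be a field of characteristic $0$ and let $L$ be a Lie algebra over $\mathbb{K}$ which is complete with respect to its lower descending series, with Baker-Campbell-Hausdorff product $\bullet\colon L\times L\to L$. For every positive integer $k$ and every $a_1,\ldots,a_k\in L$, we have $$a_k\bullet a_{k-1}\bullet\cdots\bullet a_1=\sum_{(\Gamma,f)\in\mathcal{B}(a_1\le a_2\le\cdots\le a_k)} b_{(\Gamma,f)}\,Z_\Gamma(f),$$ $$a_1\bullet a_2\bullet\cdots\bullet a_k=\sum_{n=1}^{+\infty}(-1)^{n-1}\sum_{(\Gamma,f)\in\mathcal{B}_n(a_1\le a_2\le\cdots\le a_k)} b_{(\Gamma,f)}\,Z_\Gamma(f).$$ In particular, for $a,b\in L$, we have $$a\bullet b=\sum_{(\Gamma,f)\in\mathcal{B}(b\le a)} b_{(\Gamma,f)}\,Z_\Gamma(f).$$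
   Context: **Lie algebra and BCH product.** The lower descending series is $L^1=L$, $L^{n+1}=[L^n,L]$; completeness means that the natural map $L\to\varprojlim_n L/L^n$ is an isomorphism. The Baker-Campbell-Hausdorff product is defined formally by $a\bullet b=\log(e^ae^b)$, i.e. $a\bullet b=a+b+\frac12[a,b]+\frac1{12}[a,[a,b]]-\frac1{12}[b,[b,a]]+\cdots$ is the convergent evaluation in $L$ of the universal Lie series $\log(e^ae^b)$. It is associative. **Trees.** $\mathcal{B}_n$ is the (finite) set of isomorphism classes of finite planar rooted binary trees with $n$ leaves, directed towards the root: every internal vertex (vertex with at least one incoming edge) has exactly two incoming edges, which are ordered from left to right. A leaf is a vertex without incoming edges; $\mathcal{B}_1$ consists of the tree with a single vertex (which is a leaf). Put $\mathcal{B}=\bigcup_{n>0}\mathcal{B}_n$. For $\Gamma\in\mathcal{B}$, $L(\Gamma)$ denotes its set of leaves. For vertices $u,v$, write $u\to v$ if $v$ belongs to the directed path from $u$ to the root (in particular $u\to u$). **Subroots.** An edge ending in an internal vertex $v$ is a rightmost edge if it is the last, in the left-to-right order, among the edges ending in $v$. A rightmost branch of $\Gamma$ is a maximal connected subgraph all of whose edges are rightmost edges; it is non trivial if it has at least two vertices. Every non trivial rightmost branch contains exactly one leaf. For an internal vertex $v$, $m(v)$ is the leaf lying on the rightmost branch containing $v$, and $d(v)$ is the distance (number of edges) between $v$ and $m(v)$. A subroot is the vertex of a non trivial rightmost branch which is nearest to the root; $R(\Gamma)$ is the set of subroots of $\Gamma$ (empty if $\Gamma$ has only one vertex). **Posetted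 trees.** Define a partial order $\preceq$ on $L(\Gamma)$ by: $l_1\preceq l_2$ if $l_1=l_2$ or there exists $v\in R(\Gamma)$ such that $l_2=m(v)$ and $l_1\to v$. For a poset $(A,\le)$, $\mathcal{B}_n(A)$ is the set of pairs $(\Gamma,f)$ with $\Gamma\in\mathcal{B}_n$ and $f\colon(L(\Gamma),\preceq)\to(A,\le)$ a monotone (order-preserving) map; $\mathcal{B}(A)=\bigcup_{n>0}\mathcal{B}_n(A)$. The notation $\mathcal{B}(a_1\le\cdots\le a_k)$ (resp. $\mathcal{B}_n(a_1\le\cdots\le a_k)$) means $\mathcal{B}(A)$ (resp. $\mathcal{B}_n(A)$) for $A$ the totally ordered set of $k$ distinct formal labels $a_1<a_2<\cdots<a_k$, each label being then evaluated as the corresponding element of $L$ (so labels with different indices count as different labels even if the corresponding elements of $L$ coincide). Similarly $\mathcal{B}(b\le a)$ uses the two-element chain of labels $b<a$. **Products.** $Z_\Gamma(f)\in L$ is the element obtained by placing $f(l)$ at each leaf $l$ and performing the bracket of $L$ at every internal vertex, in the left-right order given by planarity: the value at an internal vertex is $[x,y]$ where $x$ is the value of its left child and $y$ that of its right child; $Z_\Gamma(f)$ is the value at the root (for the one-vertex tree with leaf $l$, $Z_\Gamma(f)=f(l)$). **Coefficients.** The rational numbers $b_n$, $n\ge0$, are defined by $\sum_{n\ge0}b_nx^n=\frac{x}{e^x-1}$. For a posetted tree $(\Gamma,f)$, $$b_{(\Gamma,f)}=\prod_{v\in R(\Gamma)}\frac{b_{d(v)}}{t(v)},$$ where $t(v)$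 is the number of leaves $u\in L(\Gamma)$ such that $u\to v$ and $f(u)=f(m(v))$ (equality of labels); the empty product is $1$. Sums over $\mathcal{B}(A)$, with $A$ finite, mean $\sum_{n\ge1}$ of the finite sums over $\mathcal{B}_n(A)$, converging in $L$ because terms with $n$ leaves lie in $L^n$. *)

(* Defs.v *)
From HB Require Import structures.
From mathcomp Require Import all_boot all_order all_algebra.
From mathcomp Require Import boolp classical_sets functions.

Set Implicit Arguments.
Unset Strict Implicit.
Unset Printing Implicit Defensive.

Import Order.TTheory GRing.Theory Num.Theory.
Local Open Scope ring_scope.
Local Open Scope classical_set_scope.

HB.mixin Record Lmodule_isLieAlgebra (K : fieldType) L of GRing.Lmodule K L := {
  lie : L -> L -> L;
  lie_linear_left : forall y, linear (fun x => lie x y);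
  lie_linear_right : forall x, linear (lie x);
  lie_alternating : forall x, lie x x = 0;
  lie_jacobi : forall x y z,
    lie x (lie y z) + lie y (lie z x) + lie z (lie x y) = 0
}.

#[short(type="lieAlgType")]
HB.structure Definition LieAlgebra (K : fieldType) :=
  {L of GRing.Lmodule K L & Lmodule_isLieAlgebra K L}.

Definition lspan (K : fieldType) (V : lmodType K) (A : set V) : set V :=
  [set x | exists (n : nat) (c : 'I_n -> K) (v : 'I_n -> V),
     (forall i, A (v i)) /\ x = \sum_(i < n) c i *: v i].

(* [lcs n] is L^n for n >= 1; the conventional value L^0 = L is harmless,
   L / L^0 being trivial. *)
Fixpoint lcs (K : fieldType) (L : lieAlgType K) (n : nat) : set L :=
  match n with
  | 0 | 1 => [set: L]
  | m.+1 => lspan [set z | exists x y : L, lcs m x /\ z = lie x y]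
  end.

(* The class of x in L / L^n, as a subset of L. *)
Definition lcs_coset (K : fieldType) (L : lieAlgType K) (n : nat) (x : L) :
  set L := [set y | lcs n (y - x)].

(* The inverse limit of the L / L^n: the projection L / L^n.+1 -> L / L^n maps
   a coset to the unique coset containing it. *)
Definition lcs_invlim (K : fieldType) (L : lieAlgType K) : set (nat -> set L) :=
  [set s | (forall n, exists x, s n = lcs_coset n x) /\
           (forall n, s n.+1 `<=` s n)].

Definition lie_complete (K : fieldType) (L : lieAlgType K) : Prop :=
  set_bij [set: L] (@lcs_invlim K L) (fun x n => lcs_coset n x).

(* [lie_series u x]: u 1 + u 2 + ... converges to x in L. *)
Definition lie_series (K : fieldType) (L : lieAlgType K) (u : nat -> L) (x : L) :
  Prop :=
  forall n, exists N0, forall N, (N0 <= N)%N ->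
    lcs n (\sum_(1 <= i < N.+1) u i - x).

(* Elements of Q<<T>>, given by the coefficient of each word. *)
Definition ncseries (T : Type) := seq T -> rat.

Definition nc1 (T : eqType) : ncseries T := fun w => (w == [::])%:R.

Definition ncX (T : eqType) (x : T) : ncseries T := fun w => (w == [:: x])%:R.

Definition ncmul (T : Type) (f g : ncseries T) : ncseries T :=
  fun w => \sum_(i < (size w).+1) f (take i w) * g (drop i w).

Definition ncpow (T : eqType) (f : ncseries T) (n : nat) : ncseries T :=
  iter n (ncmul f) (@nc1 T).

(* If f has no constant term then f^n vanishes on words of length < n, so the
   sums over n in the following two definitions may be cut at the length. *)
Definition ncexp (T : eqType) (f : ncseries T) : ncseries T :=
  fun w => \sum_(n < (size w).+1) ncpow f n w / (n`!)%:R.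

Definition nclog (T : eqType) (g : ncseries T) : ncseries T :=
  let f := fun w => g w - nc1 w in
  fun w => \sum_(1 <= n < (size w).+1) (-1) ^+ n.-1 / n%:R * ncpow f n w.

(* log (e^X e^Y) with X := false and Y := true. *)
Definition bch_series : ncseries bool :=
  nclog (ncmul (ncexp (ncX false)) (ncexp (ncX true))).

Inductive lie_poly (T : Type) : Type :=
| LieVar of T
| LieZero
| LieAdd of lie_poly T & lie_poly T
| LieScale of rat & lie_poly T
| LieBracket of lie_poly T & lie_poly T.

Fixpoint lie_poly_nc (T : eqType) (p : lie_poly T) : ncseries T :=
  match p with
  | LieVar x => ncX x
  | LieZero => fun _ => 0
  | LieAdd p q => fun w => lie_poly_nc p w + lie_poly_nc q w
  | LieScale c p => fun w => c * lie_poly_nc p w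
  | LieBracket p q =>
      fun w => ncmul (lie_poly_nc p) (lie_poly_nc q) w
             - ncmul (lie_poly_nc q) (lie_poly_nc p) w
  end.

Fixpoint lie_poly_eval (K : fieldType) (L : lieAlgType K) (T : Type)
    (ev : T -> L) (p : lie_poly T) : L :=
  match p with
  | LieVar x => ev x
  | LieZero => 0
  | LieAdd p q => lie_poly_eval ev p + lie_poly_eval ev q
  | LieScale c p => ratr c *: lie_poly_eval ev p
  | LieBracket p q => lie (lie_poly_eval ev p) (lie_poly_eval ev q)
  end.

(* c is the evaluation at (a, b) of log (e^X e^Y), seen as a Lie series: [P n]
   is a Lie polynomial whose image in Q<<X, Y>> is the homogeneous component of
   degree n of log (e^X e^Y). *)
Definition is_bch (K : fieldType) (L : lieAlgType K) (a b c : L) : Prop :=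
  exists P : nat -> lie_poly bool,
    (forall n w, lie_poly_nc (P n) w =
                 if size w == n then bch_series w else 0) /\
    lie_series (fun n => lie_poly_eval (fun i => if i then b else a) (P n)) c.

(* When L is complete (in characteristic 0) there is exactly one c such that
   [is_bch a b c], so that the default value 0 is never used. *)
Definition bch (K : fieldType) (L : lieAlgType K) (a b : L) : L :=
  xget 0 [set c | is_bch a b c].

(* x1 . x2 . ... . xk, bracketed to the left. *)
Definition bch_prod (K : fieldType) (L : lieAlgType K) (s : seq L) : L :=
  if s is x :: s' then foldl (@bch K L) x s' else 0.

Local Close Scope classical_set_scope.

(* The pairs (Gamma, f) with f an arbitrary map from the leaves to A. *)
Inductive ltree (A : Type) : Type :=
| Leaf of A
| Node of ltree A & ltree A.
Arguments Leaf {A}.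
Arguments Node {A}.

Fixpoint ltree_code (A : Type) (t : ltree A) : GenTree.tree A :=
  match t with
  | Leaf a => GenTree.Leaf a
  | Node l r => GenTree.Node 0 [:: ltree_code l; ltree_code r]
  end.

Fixpoint ltree_decode (A : Type) (t : GenTree.tree A) : option (ltree A) :=
  match t with
  | GenTree.Leaf a => Some (Leaf a)
  | GenTree.Node 0 [:: l; r] =>
      match ltree_decode l, ltree_decode r with
      | Some l', Some r' => Some (Node l' r')
      | _, _ => None
      end
  | _ => None
  end.

Lemma ltree_codeK (A : Type) : pcancel (@ltree_code A) (@ltree_decode A).
Proof. by elim=> //= l -> r ->. Qed.

HB.instance Definition _ (A : choiceType) :=
  Choice.copy (ltree A) (pcan_type (@ltree_codeK A)).

Fixpoint nleaves (A : Type) (t : ltree A) : nat :=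
  match t with
  | Leaf _ => 1
  | Node l r => nleaves l + nleaves r
  end.

Fixpoint tree_val (K : fieldType) (L : lieAlgType K) (A : Type) (ev : A -> L)
    (t : ltree A) : L :=
  match t with
  | Leaf a => ev a
  | Node l r => lie (tree_val ev l) (tree_val ev r)
  end.

(* A vertex is given by the path from the root to it: false is a left turn,
   true is a right turn. *)
Fixpoint vertices (A : Type) (t : ltree A) : seq (seq bool) :=
  match t with
  | Leaf _ => [:: [::]]
  | Node l r => [::] :: [seq false :: s | s <- vertices l]
                     ++ [seq true :: s | s <- vertices r]
  end.

Definition vertex (A : Type) (t : ltree A) := seq_sub (vertices t).

(* The label of the leaf at address s (a junk value if there is no leaf there). *)
Fixpoint label_at (A : Type) (t : ltree A) (s : seq bool) : A :=
  match t with
  | Leaf a => a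
  | Node l r => if s is c :: s' then label_at (if c then r else l) s'
                else label_at l [::]
  end.

Section PosettedTrees.
Variables (A : Type) (t : ltree A).
Implicit Types u v l : vertex t.

(* Edges are directed towards the root: [edge u v] is an edge ending in v. *)
Definition edge u v : bool := [exists c : bool, val u == rcons (val v) c].

Definition right_edge u v : bool := val u == rcons (val v) true.

Definition is_leaf v : bool := [forall u, ~~ edge u v].

(* u -> v *)
Definition below u v : bool := prefix (val v) (val u).

Definition depth v : nat := size (val v).

Definition label v : A := label_at t (val v).

(* The rightmost branch containing v: its connected component in the graph of
   the rightmost edges. *)
Definition branch v : {set vertex t} :=
  [set u | connect (fun x y => right_edge x y || right_edge y x) v u].

Definition branch_leaf v : vertex t :=
  odflt v [pick l | is_leaf l && (l \in branch v)].

(* The distance from v to m(v); m(v) is a descendant of v. *)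
Definition branch_dist v : nat := (depth (branch_leaf v) - depth v)%N.

Definition subroots : {set vertex t} :=
  [set v | (1 < #|branch v|)%N && [forall u in branch v, (depth v <= depth u)%N]].

Definition leaf_le l1 l2 : bool :=
  (l1 == l2) || [exists v in subroots, (l2 == branch_leaf v) && below l1 v].

End PosettedTrees.

Definition posetted d (A : porderType d) (t : ltree A) : bool :=
  [forall l1 : vertex t, forall l2 : vertex t,
     [&& is_leaf l1, is_leaf l2 & leaf_le l1 l2] ==>
     (label l1 <= label l2)%O].

Fixpoint ltrees_rec (A : finType) (fuel n : nat) : seq (ltree A) :=
  if fuel is fuel'.+1 then
    (if n == 1%N then [seq Leaf a | a <- enum A] else [::]) ++
    flatten [seq [seq Node l r | l <- ltrees_rec A fuel' i,
                                 r <- ltrees_rec A fuel' (n - i)]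
            | i <- iota 1 n.-1]
  else [::].

Definition ltrees (A : finType) (n : nat) : seq (ltree A) := ltrees_rec A n n.

Definition posetted_trees d (A : finPOrderType d) (n : nat) : seq (ltree A) :=
  [seq t <- ltrees A n | posetted t].

Fixpoint bernoulli_seq (n : nat) : seq rat :=
  if n is m.+1 then
    let s := bernoulli_seq m in
    rcons s ((m == 0%N)%:R - \sum_(k < m) s`_k / ((m - k).+1`!)%:R)
  else [::].

Definition bernoulli (n : nat) : rat := (bernoulli_seq n.+1)`_n.

Lemma size_bernoulli_seq n : size (bernoulli_seq n) = n.
Proof. by elim: n => //= n IHn; rewrite size_rcons IHn. Qed.

Lemma nth_bernoulli_seq n k : (k < n)%N -> (bernoulli_seq n)`_k = bernoulli k.
Proof.
elim: n => // n IHn; rewrite ltnS leq_eqVlt => /predU1P[-> //|lt_kn].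
by rewrite /= nth_rcons size_bernoulli_seq lt_kn IHn.
Qed.

Lemma bernoulli_rec n :
  \sum_(k < n.+1) bernoulli k / ((n - k).+1`!)%:R = (n == 0%N)%:R.
Proof.
rewrite big_ord_recr /= subnn divr1 {2}/bernoulli /= nth_rcons.
rewrite size_bernoulli_seq ltnn eqxx addrC.
under [X in _ - X]eq_bigr => k _ do rewrite nth_bernoulli_seq //.
by rewrite subrK.
Qed.

(* (sum_n b_n x^n) (e^x - 1) = x *)
Lemma bernoulli_gen n :
  \sum_(k < n.+1) bernoulli k * (((n - k)`!)%:R^-1 - (n - k == 0)%N%:R)
  = (n == 1%N)%:R.
Proof.
rewrite big_ord_recr /= subnn subrr mulr0 addr0.
case: n => [|n]; first by rewrite big_ord0.
rewrite eqSS -bernoulli_rec; apply: eq_bigr => k _.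
by rewrite subSn ?subr0 // -ltnS.
Qed.

(* t(v) *)
Definition leaf_mult (A : eqType) (t : ltree A) (v : vertex t) : nat :=
  #|[set u : vertex t | [&& is_leaf u, below u v &
                           label u == label (branch_leaf v)]]|.

Definition tree_coef (A : eqType) (t : ltree A) : rat :=
  \prod_(v in subroots t) (bernoulli (branch_dist v) / (leaf_mult v)%:R).

(* The sum over the posetted trees with n leaves. *)
Definition tree_sum (K : fieldType) (L : lieAlgType K) d (A : finPOrderType d)
    (ev : A -> L) (n : nat) : L :=
  \sum_(t <- posetted_trees A n) ratr (tree_coef t) *: tree_val ev t.

Section Enumeration.
Variable A : finType.

Lemma nleaves_gt0 (t : ltree A) : (0 < nleaves t)%N.
Proof. by elim: t => //= l IHl r _; rewrite addn_gt0 IHl. Qed.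

Lemma mem_ltrees_rec fuel n (t : ltree A) : (n <= fuel)%N ->
  (t \in ltrees_rec A fuel n) = (nleaves t == n).
Proof.
elim: fuel n t => [|fuel IH] n t.
  by rewrite leqn0 => /eqP->; rewrite gtn_eqF ?nleaves_gt0.
move=> le_nf; rewrite /= mem_cat; case: t => [a|l r] /=.
  rewrite (_ : (_ \in flatten _) = false) ?orbF.
    by rewrite eq_sym; case: ifP => // _; rewrite map_f ?mem_enum.
  apply/negP => /flatten_mapP[i _] /allpairsP[[l r]] /= [_ _].
  by [].
rewrite (_ : (_ \in (if _ then _ else _)) = false) /=; last first.
  by case: ifP => // _; apply/negP => /mapP[].
have l0 := nleaves_gt0 l; have r0 := nleaves_gt0 r.
apply/flatten_mapP/eqP => [[i] | def_n].
  rewrite mem_iota => /andP[i0 lt_in] /allpairsP[[l' r']] /= [].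
  have lt_in' : (i < n)%N by case: (n) i0 lt_in => [|m] /=; case: (i).
  rewrite !IH; last 2 first.
  - by rewrite -ltnS (leq_trans _ le_nf) // ltn_subrL i0 (leq_trans _ lt_in').
  - by rewrite -ltnS (leq_trans lt_in').
  by move=> /eqP El /eqP Er [-> ->]; rewrite El Er subnKC // ltnW.
exists (nleaves l).
  by rewrite mem_iota l0 -def_n add1n prednK ?addn_gt0 ?l0 // -addn1 leq_add2l.
apply/allpairsP; exists (l, r); split=> //=; rewrite IH //.
- by rewrite -ltnS (leq_trans _ le_nf) // -def_n -addn1 leq_add2l.
- by rewrite -def_n addKn.
by rewrite -ltnS (leq_trans _ le_nf) // -def_n addKn -add1n leq_add2r.
Qed.

Lemma mem_ltrees n (t : ltree A) : (t \in ltrees A n) = (nleaves t == n).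
Proof. exact: mem_ltrees_rec. Qed.

Lemma uniq_ltrees_rec fuel n : (n <= fuel)%N -> uniq (ltrees_rec A fuel n).
Proof.
elim: fuel n => // fuel IH n le_nf; rewrite /= cat_uniq; apply/and3P; split.
- by case: ifP => // _; rewrite map_inj_uniq ?enum_uniq // => a b [].
- apply/hasPn => t /flatten_mapP[i _] /allpairsP[[l r]] /= [_ _ ->].
  by case: ifP => // _; apply/negP => /mapP[].
have lt_f i : i \in iota 1 n.-1 -> (i <= fuel)%N /\ (n - i <= fuel)%N.
  rewrite mem_iota => /andP[i0 lt_in].
  have lt_in' : (i < n)%N by case: (n) i0 lt_in => [|m] /=; case: (i).
  split; first by rewrite -ltnS (leq_trans lt_in').
  by rewrite -ltnS (leq_trans _ le_nf) // ltn_subrL i0 (leq_trans _ lt_in').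
elim: (iota 1 n.-1) (iota_uniq 1 n.-1) lt_f => //= i s IHs /andP[i_s uniq_s] lt_f.
have [lei leni] := lt_f i (mem_head _ _).
have lt_s j : j \in s -> (j <= fuel)%N /\ (n - j <= fuel)%N.
  by move=> js; apply: lt_f; rewrite inE js orbT.
rewrite cat_uniq allpairs_uniq ?IH ?IHs //=; last by case=> ? ? [? ?] _ _ [-> ->].
rewrite andbT; apply/hasPn => t /flatten_mapP[j js].
have [lej _] := lt_s j js.
move=> /allpairsP[[l r]] /= [+ _ ->]; rewrite mem_ltrees_rec // => /eqP El.
apply/negP => /allpairsP[[l' r']] /= [+ _ []].
rewrite mem_ltrees_rec // => /eqP El' Ell' _.
by move: i_s; rewrite -El' -Ell' El js.
Qed.

Lemma uniq_ltrees n : uniq (ltrees A n).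
Proof. exact: uniq_ltrees_rec. Qed.

End Enumeration.

(* Main.v *)
(* Words in the labels span Q<<T>>. Cutting a posetted tree along its root spine
   shows that the sum Z_j of the trees with labels below j satisfies, for the
   derivation D counting occurrences of the letter x = j,
     D Z_(j+1) = sum_d b_d (ad Z_(j+1))^d x,
   the factor 1 / t(root) being absorbed by D. As D (e^Z) = ((e^(ad Z) - 1) / ad Z)
   (D Z) e^Z, this says D (e^(Z_(j+1))) = x e^(Z_(j+1)). The series e^x e^(Z_j)
   satisfies the same equation and agrees on the words without x, hence
   e^(Z_(j+1)) = e^x e^(Z_j) and e^(Z_k) is the product of the exponentials of the
   letters. For k = 2 this exhibits the Baker-Campbell-Hausdorff series as a Lie
   series. By the Dynkin-Specht-Wever identity, the value in L of a Lie series
   depends on its coefficients only, so that an iterated BCH product is the value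
   of any Lie series whose exponential is the product of the e^(a_i). Reversal of
   words multiplies a Lie polynomial of degree n by (-1)^(n-1) and reverses the
   product of exponentials, which gives the second formula. *)

From HB Require Import structures.
Require Import Defs.
From mathcomp Require Import all_boot all_order all_algebra.
From mathcomp Require Import boolp classical_sets functions.
From mathcomp Require Import ring.

Set Implicit Arguments.
Unset Strict Implicit.
Unset Printing Implicit Defensive.

Import Order.TTheory GRing.Theory Num.Theory.
Local Open Scope ring_scope.

(** * Noncommutative power series *)

(** The constants are forced by the equation: the derivative of e^Z carries the factor (e^(ad Z) -
    1) / ad Z, and the only way to leave the bare letter x is to feed it the inverse series, whose
    coefficients are the b_d. The weight 1 / t undoes an eigenvalue: a tree is a combination of
    rearrangements of its leaf labels, so D multiplies it by its number of leaves labelled x.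
    Convergence takes the form of congruences: an identity between infinite sums is proved on words
    shorter than M, for every M. Two features of [bch] shape the passage to L. It accepts any family
    of Lie polynomials with the right coefficients, and an iterated product inserts one limit into
    another. The relation [represents] is stable under both: at each order n some Lie polynomial
    agrees with the series on words shorter than n and has the right value modulo L^n. *)

Section Words.
Variable T : eqType.
Implicit Types (f g h : ncseries T) (w : seq T) (c : T).

(* A new type, since [ncseries T] already carries the pointwise ring structure. *)
Definition ncs : Type := seq T -> rat^o.

(** Left quotient by a letter. Since f = f(1) + sum_c c (d_c f), it turns statements about products
    and substitutions into inductions on the first letter. *)
Definition ncder c f : ncs := fun w => f (c :: w).

Lemma ncmul_nil f g : ncmul f g [::] = f [::] * g [::].
Proof. by rewrite /ncmul big_ord_recl big_ord0 addr0. Qed.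

Lemma ncmul_cons f g c w :
  ncmul f g (c :: w) = f [::] * g (c :: w) + ncmul (ncder c f) g w.
Proof. by rewrite /ncmul big_ord_recl. Qed.

HB.instance Definition _ := GRing.Lmodule.copy ncs (seq T -> rat^o).

Lemma ncs_addE (f g : ncs) w : (f + g) w = f w + g w.
Proof. by []. Qed.
Lemma ncs_scaleE (f : ncs) a w : (a *: f) w = a * f w.
Proof. by []. Qed.

Fact ncmulDl : left_distributive (@ncmul T : ncs -> ncs -> ncs) +%R.
Proof.
move=> f g h; apply/funext => w; rewrite ncs_addE /ncmul -big_split.
by apply: eq_bigr => i _; rewrite ncs_addE mulrDl.
Qed.

Fact ncmulDr : right_distributive (@ncmul T : ncs -> ncs -> ncs) +%R.
Proof.
move=> f g h; apply/funext => w; rewrite ncs_addE /ncmul -big_split.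
by apply: eq_bigr => i _; rewrite ncs_addE mulrDr.
Qed.

Fact ncmulZl a (f g : ncs) : (ncmul (a *: f) g : ncs) = a *: (ncmul f g : ncs).
Proof.
apply/funext => w; rewrite ncs_scaleE /ncmul mulr_sumr.
by apply: eq_bigr => i _; rewrite ncs_scaleE mulrA.
Qed.

Fact ncmulZr a (f g : ncs) : (ncmul f (a *: g) : ncs) = a *: (ncmul f g : ncs).
Proof.
apply/funext => w; rewrite ncs_scaleE /ncmul mulr_sumr.
by apply: eq_bigr => i _; rewrite ncs_scaleE mulrCA.
Qed.

(** A Leibniz rule twisted by the constant term: the letter is taken from g only if f contributes
    the empty word. *)
Lemma ncder_mul c (f g : ncs) :
  ncder c (ncmul f g) = (f [::] : rat) *: ncder c g + (ncmul (ncder c f) g : ncs).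
Proof. by apply/funext => w; rewrite /ncder ncmul_cons. Qed.

Fact ncmulA : associative (@ncmul T : ncs -> ncs -> ncs).
Proof.
move=> f g h; apply/funext => w; elim: w f g h => [|c w IH] f g h.
  by rewrite !ncmul_nil mulrA.
rewrite !ncmul_cons ncder_mul ncmulDl ncmulZl ncs_addE ncs_scaleE.
by rewrite IH ncmul_nil mulrDr mulrA addrA.
Qed.

Fact ncmul1f : left_id (@nc1 T : ncs) (@ncmul T).
Proof.
move=> f; apply/funext; case=> [|c w]; first by rewrite ncmul_nil mul1r.
rewrite ncmul_cons mul1r [ncmul _ _ _]big1 ?addr0 // => i _.
by rewrite /ncder /nc1 mul0r.
Qed.

Fact ncmulf1 : right_id (@nc1 T : ncs) (@ncmul T).
Proof.
move=> f; apply/funext => w; elim: w f => [|c w IH] f.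
  by rewrite ncmul_nil mulr1.
by rewrite ncmul_cons IH /nc1 mulr0 add0r.
Qed.

Fact nc1_neq0 : (@nc1 T : ncs) != 0.
Proof. by apply/eqP => /(congr1 (@^~ [::])). Qed.

HB.instance Definition _ := GRing.Zmodule_isNzRing.Build ncs
  ncmulA ncmul1f ncmulf1 ncmulDl ncmulDr nc1_neq0.
HB.instance Definition _ := GRing.Lmodule_isLalgebra.Build rat ncs
  (fun a f g => esym (ncmulZl a f g)).
HB.instance Definition _ := GRing.Lalgebra_isAlgebra.Build rat ncs
  (fun a f g => esym (ncmulZr a f g)).
End Words.

(** * Congruence modulo words of length at least M *)

Section Truncation.
Variable T : eqType.
Implicit Types (f g h : ncs T) (w : seq T) (c : T).

Definition eqm M f g := forall w, (size w < M)%N -> f w = g w.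

Lemma eqm_refl M f : eqm M f f. Proof. by []. Qed.

Lemma eqm_sym M f g : eqm M f g -> eqm M g f.
Proof. by move=> fg w lt_wM; rewrite fg. Qed.

Lemma eqm_trans M f g h : eqm M f g -> eqm M g h -> eqm M f h.
Proof. by move=> fg gh w lt_wM; rewrite fg ?gh. Qed.

Lemma eqm_leq M N f g : (M <= N)%N -> eqm N f g -> eqm M f g.
Proof. by move=> le_MN fg w lt_wM; rewrite fg // (leq_trans lt_wM). Qed.

Lemma eqmP f g : (forall M, eqm M f g) -> f = g.
Proof. by move=> fg; apply/funext => w; apply: (fg (size w).+1). Qed.

Lemma ncs_subE f g w : (f - g) w = f w - g w. Proof. by []. Qed.

Lemma ncs_mulE f g w :
  (f * g) w = \sum_(i < (size w).+1) f (take i w) * g (drop i w).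
Proof. by []. Qed.

Lemma ncs_mul_nil f g : (f * g) [::] = f [::] * g [::].
Proof. exact: ncmul_nil. Qed.

Lemma ncs_mul_cons f g c w :
  (f * g) (c :: w) = f [::] * g (c :: w) + ((ncder c f : ncs T) * g) w.
Proof. exact: ncmul_cons. Qed.

Lemma ncs_sumE (I : Type) (r : seq I) (P : pred I) (F : I -> ncs T) w :
  (\sum_(i <- r | P i) F i) w = \sum_(i <- r | P i) F i w.
Proof.
elim: r => [|i r IH]; first by rewrite !big_nil.
by rewrite !big_cons; case: (P i); rewrite // ncs_addE IH.
Qed.

Lemma eqmD M f f' g g' : eqm M f f' -> eqm M g g' -> eqm M (f + g) (f' + g').
Proof. by move=> ff gg w ltM; rewrite !ncs_addE ff ?gg. Qed.

Lemma eqmB M f f' g g' : eqm M f f' -> eqm M g g' -> eqm M (f - g) (f' - g').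
Proof. by move=> ff gg w ltM; rewrite !ncs_subE ff ?gg. Qed.

Lemma eqmZ M a f f' : eqm M f f' -> eqm M (a *: f) (a *: f').
Proof. by move=> ff w ltM; rewrite !ncs_scaleE ff. Qed.

Lemma eqm_sum M (I : Type) (r : seq I) (P : pred I) (F G : I -> ncs T) :
  (forall i, P i -> eqm M (F i) (G i)) ->
  eqm M (\sum_(i <- r | P i) F i) (\sum_(i <- r | P i) G i).
Proof.
move=> FG w ltM; rewrite !ncs_sumE.
by apply: eq_bigr => i Pi; apply: FG.
Qed.

Lemma eqmM M f f' g g' : eqm M f f' -> eqm M g g' -> eqm M (f * g) (f' * g').
Proof.
move=> ff gg w ltM; rewrite !ncs_mulE; apply: eq_bigr => i _.
rewrite ff ?gg // ?size_drop ?size_take; first exact: leq_ltn_trans (leq_subr _ _) ltM.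
by case: ifP => // /ltn_trans; apply.
Qed.

Lemma eqmX M f f' n : eqm M f f' -> eqm M (f ^+ n) (f' ^+ n).
Proof.
by move=> ff; elim: n => // n IH; rewrite !exprS; apply: eqmM.
Qed.

(** In any cut of a word shorter than m + n, either the prefix is shorter than m or the suffix is
    shorter than n. *)
Lemma eqmM0 m n f g : eqm m f 0 -> eqm n g 0 -> eqm (m + n) (f * g) 0.
Proof.
move=> f0 g0 w ltM; rewrite ncs_mulE big1 // => -[i /=]; rewrite ltnS => lei _.
have [lt_im|le_mi] := ltnP i m.
  by rewrite f0 ?mul0r // size_takel.
by rewrite (g0 (drop i w)) ?mulr0 // size_drop ltn_subLR // (leq_trans ltM) ?leq_add2r.
Qed.

Lemma eqmX0 n f : eqm 1 f 0 -> eqm n (f ^+ n) 0.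
Proof.
move=> f0; elim: n => [|n IH]; first by [].
by rewrite exprS -add1n; apply: eqmM0.
Qed.

Lemma eqmMS M f g g' : eqm 1 f 0 -> eqm M g g' -> eqm M.+1 (f * g) (f * g').
Proof.
move=> f0 gg w ltM; apply/eqP; rewrite -subr_eq0 -ncs_subE -mulrBr; apply/eqP.
by apply: (@eqmM0 1 M) ltM => // v /gg; rewrite ncs_subE => ->; rewrite subrr.
Qed.

Lemma eqm1 f : f [::] = 0 -> eqm 1 f 0.
Proof. by move=> f0 [|]. Qed.

Lemma ncpowE f n : ncpow f n = f ^+ n.
Proof. by elim: n => //= n IH; rewrite exprS -IH. Qed.

(** The definitions of exp and log cut their sums at a bound depending on the word. As u n vanishes
    on words shorter than n, the bound can be made uniform, giving a genuine polynomial in f. *)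
Lemma nc_trunc (u : nat -> ncs T) (a : nat -> rat) m M :
    (forall n, eqm n (u n) 0) ->
  eqm M (fun w => \sum_(m <= n < (size w).+1) a n * u n w)
        (\sum_(m <= n < M) a n *: u n).
Proof.
move=> u0 w ltM; rewrite ncs_sumE.
have [le_mw|lt_wm] := leqP m (size w).+1; last first.
  rewrite big_geq ?(ltnW lt_wm) // big_nat big1 // => i /andP[le_mi _].
  by rewrite ncs_scaleE u0 ?mulr0 // (leq_trans _ le_mi) // ltnW.
rewrite (@big_cat_nat _ _ _ (size w).+1 m M) //= -[LHS]addr0; congr (_ + _).
rewrite big_nat big1 // => i /andP[lei _].
by rewrite ncs_scaleE u0 ?mulr0.
Qed.

Definition nX c : ncs T := ncX c.
Definition nexp f : ncs T := ncexp f.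
Definition nlog f : ncs T := nclog f.

Lemma nexp_eqm M f : f [::] = 0 ->
  eqm M (nexp f) (\sum_(n < M) (n`!%:R^-1 : rat) *: f ^+ n).
Proof.
move=> f0; rewrite -(big_mkord xpredT (fun n => (n`!%:R^-1 : rat) *: f ^+ n)).
have u0 n : eqm n (f ^+ n) 0 by exact: eqmX0 (eqm1 f0).
apply: (eqm_trans _ (nc_trunc (fun n => n`!%:R^-1) 0 u0)) => w _.
rewrite /nexp /ncexp big_mkord; apply: eq_bigr => i _.
by rewrite ncpowE mulrC.
Qed.

Lemma nlog_eqm M f : f [::] = 1 ->
  eqm M (nlog f) (\sum_(1 <= n < M) ((-1) ^+ n.-1 / n%:R : rat) *: (f - 1) ^+ n).
Proof.
move=> f1.
have f0 : (f - 1) [::] = 0 by rewrite ncs_subE f1 subrr.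
have u0 n : eqm n ((f - 1) ^+ n) 0 by exact: eqmX0 (eqm1 f0).
apply: (eqm_trans _ (nc_trunc (fun n => (-1) ^+ n.-1 / n%:R) 1 u0)) => w _.
by rewrite /nlog /nclog; apply: eq_bigr => i _; rewrite ncpowE.
Qed.

Lemma nexp_nil f : nexp f [::] = 1.
Proof. by rewrite /nexp /ncexp big_ord_recl big_ord0 addr0 divr1. Qed.

End Truncation.

(** * Exponential and logarithm *)

Definition exp_poly M : {poly rat} := \sum_(n < M) (n`!%:R^-1 : rat) *: 'X^n.
Definition log_poly M : {poly rat} :=
  \sum_(1 <= n < M) ((-1) ^+ n.-1 / n%:R : rat) *: 'X^n.

Lemma deriv_exp_poly m :
  (exp_poly m.+1)^`() = exp_poly m.+1 - (m`!%:R^-1 : rat) *: 'X^m.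
Proof.
rewrite {2}/exp_poly big_ord_recr /= addrK /exp_poly big_ord_recl /= linearD /=.
rewrite derivZ derivXn mulr0n scaler0 add0r raddf_sum /=.
apply: eq_bigr => i _; rewrite derivZ derivXn -scaler_nat scalerA /=.
by rewrite factS natrM invfM mulrAC mulVf ?mul1r // pnatr_eq0.
Qed.

Lemma deriv_log_poly m :
  (1 + 'X) * (log_poly m.+1)^`() = 1 - (- 'X) ^+ m.
Proof.
rewrite -[RHS]opprB subrX1 -mulNr opprB opprK; congr (_ * _).
rewrite /log_poly big_add1 big_mkord raddf_sum; apply: eq_bigr => i _ /=.
rewrite derivZ derivXn /= -scaler_nat scalerA divfK ?pnatr_eq0 //.
by rewrite [RHS]exprNn -mul_polyC polyC_exp polyCN polyC1.
Qed.

(** Let Q be the difference. The two differential equations above make X^m divide (1 + E) Q', and 1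
    + E is prime to X, so Q' has no coefficient below m. Together with Q(0) = 0 this kills the
    coefficients of Q up to degree m. *)
Lemma log_exp_poly m :
  'X^(m.+1) %| (log_poly m.+1 \Po (exp_poly m.+1 - 1)) - 'X.
Proof.
set E := exp_poly m.+1 - 1; set Q := _ - 'X.
have E0 : E.[0] = 0.
  rewrite /E /exp_poly big_ord_recl !hornerE horner_sum big1 ?addr0 => [|i _].
    by rewrite subrr.
  by rewrite hornerZ hornerXn expr0n mulr0.
have XE : 'X %| E by rewrite -['X]subr0 -polyC0 dvdp_XsubCl /root E0.
have dE : E^`() = 1 + E - (m`!%:R^-1 : rat) *: 'X^m.
  by rewrite /E linearB /= deriv_exp_poly -polyC1 derivC subr0; ring.
have dQ : (1 + E) * Q^`() =
          - ((m`!%:R^-1 : rat) *: 'X^m) - (- E) ^+ m * E^`().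
  rewrite /Q linearB /= derivX deriv_comp mulrBr mulr1 mulrA.
  have := congr1 (fun p : {poly rat} => p \Po E) (deriv_log_poly m).
  rewrite rmorphM rmorphD /= comp_polyX rmorph1 /= => ->.
  rewrite rmorphB rmorph1 rmorphXn rmorphN /= comp_polyX.
  rewrite mulrBl mul1r dE; ring.
have : 'X^m %| (1 + E) * Q^`().
  rewrite dQ dvdp_sub //; first by rewrite -scaleNr -mul_polyC dvdp_mulIr.
  by rewrite dvdp_mulr // dvdp_exp2r // -scaleN1r dvdpZr.
rewrite Gauss_dvdpr; last first.
  by rewrite coprimep_expl // coprimep_sym coprimepX /root hornerD E0 addr0 hornerC oner_eq0.
move=> dvdQ.
have dQ0 i : (i < m)%N -> Q^`()`_i = 0.
  by move=> lt_im; have /dvdpP[r ->] := dvdQ; rewrite coefMXn lt_im.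
suff -> : Q = drop_poly m.+1 Q * 'X^(m.+1) by rewrite dvdp_mulIr.
rewrite -{1}(poly_take_drop m.+1 Q) [take_poly _ _](_ : _ = 0) ?add0r //.
apply/polyP => i; rewrite coef_take_poly coef0; case: ltnP => // lt_im.
case: i lt_im => [|i] lt_im; last first.
  have := dQ0 i lt_im; rewrite coef_deriv => /eqP.
  by rewrite mulrn_eq0 /= => /eqP.
rewrite -horner_coef0 /Q !hornerE horner_comp E0 /log_poly horner_sum.
rewrite big_add1 big_mkord big1 ?subr0 // => j _.
by rewrite hornerZ hornerXn expr0n mulr0.
Qed.

Section ExpLog.
Variable T : eqType.
Implicit Types f g : ncs T.

(** The powers of a single f commute, so the identity is the image of [log_exp_poly] under X |-> f;
    the multiple of f^(M+1) left over vanishes on words of length at most M. *)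
Lemma nlog_nexp f : f [::] = 0 -> nlog (nexp f) = f.
Proof.
move=> f0; apply: eqmP => M; apply: (@eqm_leq _ _ M.+1) => //.
apply: eqm_trans (@nlog_eqm _ _ _ _) _; first by rewrite nexp_nil.
have ev_exp : eqm M.+1 (nexp f - 1) (horner_alg f (exp_poly M.+1 - 1)).
  rewrite rmorphB rmorph1; apply: eqmB => //; apply: eqm_trans (nexp_eqm f0) _.
  rewrite /exp_poly raddf_sum; apply: eqm_sum => i _ /=.
  by rewrite -mul_polyC rmorphM rmorphXn /= horner_algC horner_algX mulr_algl.
have [r /eqP] := dvdpP _ _ (log_exp_poly M).
rewrite subr_eq => /eqP /(congr1 (horner_alg f)).
rewrite rmorphD rmorphM rmorphXn /= horner_algX.
move=> E; apply: (@eqm_trans _ _ _ (horner_alg f r * f ^+ M.+1 + f)).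
  rewrite -E /log_poly !raddf_sum; apply: eqm_sum => i _ /=.
  rewrite comp_polyZ -mul_polyC rmorphM /= comp_Xn_poly rmorphXn /= horner_algC mulr_algl.
  by apply: eqmZ; apply: eqmX.
rewrite -[X in eqm _ _ X]add0r; apply: eqmD => //.
have : eqm M.+1 (f ^+ M.+1) 0 by exact: eqmX0 (eqm1 f0).
by move=> /(eqmM (@eqm_refl _ _ (horner_alg f r))); rewrite mulr0.
Qed.

Lemma nexp_inj f g : f [::] = 0 -> g [::] = 0 -> nexp f = nexp g -> f = g.
Proof. by move=> f0 g0 E; rewrite -(nlog_nexp f0) E nlog_nexp. Qed.
End ExpLog.

(** * The differential equation of the exponential *)

Lemma sum_triangle (V : nmodType) (F : nat -> nat -> V) M :
    (forall i j, (M <= i + j)%N -> F i j = 0) ->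
  \sum_(i < M) \sum_(j < M) F i j = \sum_(n < M) \sum_(i < n.+1) F i (n - i)%N.
Proof.
move=> F0; transitivity (\sum_(i < M) \sum_(n < M | (i <= n)%N) F i (n - i)%N).
  apply: eq_bigr => i _; rewrite -(big_mkord xpredT (F i)).
  rewrite -(big_mkord (fun n => (i <= n)%N) (fun n => F i (n - i)%N)).
  have lt_iM := ltn_ord i.
  rewrite (@big_cat_nat _ _ _ (M - i) 0 M) ?leq_subr //=.
  rewrite [X in _ + X]big_nat [X in _ + X]big1 ?addr0 => [|j]; last first.
    by rewrite leq_subLR => /andP[le_M _]; apply: F0.
  rewrite [RHS](@big_cat_nat _ _ _ i 0 M) ?(ltnW lt_iM) //=.
  rewrite [X in _ = X + _]big_nat_cond [X in _ = X + _]big1 ?add0r => [|j].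
    have := @big_addn V 0 +%R 0 M i (fun n => (i <= n)%N) (fun n => F i (n - i)%N).
    rewrite add0n => ->; rewrite [RHS]big_mkcond.
    by apply: eq_big_nat => j _; rewrite leq_addl addnK.
  by case/andP=> /andP[_ lt_ji]; rewrite leqNgt lt_ji.
rewrite (exchange_big_dep xpredT) //=; apply: eq_bigr => n _.
rewrite -(big_mkord xpredT (fun i => F i (n - i)%N)).
rewrite -(big_mkord (fun i => (i <= n)%N) (fun i => F i (n - i)%N)).
rewrite (@big_cat_nat _ _ _ n.+1 0 M) //=.
rewrite [X in _ + X]big_nat_cond [X in _ + X]big1 ?addr0 => [|j].
  rewrite [LHS]big_mkcond [LHS]big_nat [RHS]big_nat.
  by apply: eq_bigr => i /=; rewrite ltnS => ->.
by case/andP=> /andP[lt_nj _]; rewrite leqNgt lt_nj.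
Qed.

Section Commutator.
Variable R : pzRingType.
Implicit Types y z : R.

Definition adr z y : R := z * y - y * z.

(** Left multiplication by z is l = ad z + r with r the right multiplication, which commutes with ad
    z. The left side is (l^n - r^n) / (l - r) applied to y, and the right side is its binomial
    expansion. Pascal's rule gives the induction. *)
Lemma sum_adr z y n :
  \sum_(i < n) z ^+ i * y * z ^+ (n - i.+1) =
  \sum_(m < n) (iter m (adr z) y * z ^+ (n - m.+1)) *+ 'C(n, m.+1).
Proof.
elim: n => [|n IH]; first by rewrite !big_ord0.
rewrite big_ord_recl expr0 mul1r subn1 /=.
under eq_bigr => i _ do rewrite exprS -!mulrA subSS (mulrA (z ^+ i)).
rewrite -mulr_sumr IH mulr_sumr.
under [RHS]eq_bigr => m _ do rewrite binS mulrnDr subSS.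
rewrite big_split /= [X in _ = X + _]big_ord_recr /= bin_small // mulr0n addr0.
rewrite [X in _ = _ + X]big_ord_recl /= bin0 mulr1n subn0 addrCA -big_split /=.
congr (_ + _); apply: eq_bigr => m _; rewrite -mulrnDl mulrnAr; congr (_ *+ _).
have -> : z ^+ (n - m) = z * z ^+ (n - m.+1) by rewrite -exprS subnSK.
rewrite /bump add1n /= add0n [adr z _]/(z * _ - _ * z) mulrBl !mulrA.
by rewrite addrC subrK.
Qed.

Lemma iter_adr0 z n : iter n (adr z) 0 = 0.
Proof. by elim: n => //= n ->; rewrite /adr mulr0 mul0r subrr. Qed.
End Commutator.

Lemma bernoulli0 : bernoulli 0 = 1.
Proof. by have := bernoulli_rec 0; rewrite big_ord_recl big_ord0 addr0 divr1. Qed.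

Section Derivation.
Variables (T : eqType) (x : T).
Implicit Types (f g z : ncs T) (w : seq T).

Definition cder f : ncs T := fun w => (count_mem x w)%:R * f w.

Lemma cderE f w : cder f w = (count_mem x w)%:R * f w. Proof. by []. Qed.

Lemma cderM f g : cder (f * g) = cder f * g + f * cder g.
Proof.
apply/funext => w; rewrite cderE ncs_addE !ncs_mulE mulr_sumr -big_split /=.
apply: eq_bigr => i _; rewrite !cderE -{1}(cat_take_drop i w) count_cat natrD.
by rewrite mulrDl mulrA mulrCA.
Qed.

Lemma cder1 : cder 1 = 0.
Proof. by apply/funext => -[|c w]; rewrite cderE ?mul0r // mulr0. Qed.

Lemma cderX f n : cder (f ^+ n) = \sum_(i < n) f ^+ i * cder f * f ^+ (n - i.+1).
Proof.
elim: n => [|n IH]; first by rewrite big_ord0 cder1.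
rewrite exprS cderM IH big_ord_recl expr0 mul1r subn1 /=; congr (_ + _).
by rewrite mulr_sumr; apply: eq_bigr => i _; rewrite exprS subSS !mulrA.
Qed.

Lemma eqm_cder M f g : eqm M f g -> eqm M (cder f) (cder g).
Proof. by move=> fg w ltM; rewrite !cderE fg. Qed.

Lemma cder_sum (I : Type) (r : seq I) (P : pred I) (a : I -> rat) (F : I -> ncs T) :
  cder (\sum_(i <- r | P i) a i *: F i) = \sum_(i <- r | P i) a i *: cder (F i).
Proof.
apply/funext => w; rewrite cderE !ncs_sumE mulr_sumr; apply: eq_bigr => i _.
by rewrite !ncs_scaleE cderE mulrCA.
Qed.

Lemma cder0_eqm f : eqm 1 (cder f) 0.
Proof. by case=> // _; rewrite cderE mul0r. Qed.

Lemma eqm_adr M z f g : eqm M f g -> eqm M (adr z f) (adr z g).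
Proof. by move=> fg; apply: eqmB; apply: eqmM. Qed.

Lemma eqm_adrS M z f g : eqm 1 z 0 -> eqm M f 0 -> eqm M.+1 (adr z f) 0.
Proof.
move=> z0 f0; rewrite -(subrr 0) /adr; apply: eqmB.
  by rewrite -add1n; apply: eqmM0.
by rewrite -addn1; apply: eqmM0.
Qed.

Lemma eqm_iter_adr M n z f : eqm 1 z 0 -> eqm M f 0 -> eqm (n + M) (iter n (adr z) f) 0.
Proof. by move=> z0 f0; elim: n => //= n IH; apply: eqm_adrS. Qed.

Lemma iter_adr_sum z n (I : Type) (r : seq I) (P : pred I) (a : I -> rat) (F : I -> ncs T) :
  iter n (adr z) (\sum_(i <- r | P i) a i *: F i) =
  \sum_(i <- r | P i) a i *: iter n (adr z) (F i).
Proof.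
elim: n => //= n ->; rewrite /adr mulr_sumr mulr_suml -sumrB.
by apply: eq_bigr => i _; rewrite scalerBr -scalerAl -scalerAr.
Qed.

(* The derivative of e^z is ((e^{ad z} - 1) / ad z) (z') e^z. *)
Lemma cder_nexp M z : z [::] = 0 ->
  eqm M (cder (nexp z))
    ((\sum_(m < M) (m.+1`!%:R^-1 : rat) *: iter m (adr z) (cder z)) * nexp z).
Proof.
move=> z0; have z1 := eqm1 z0.
apply: eqm_trans (eqm_cder (nexp_eqm z0)) _.
apply: eqm_trans; last first.
  by apply: eqmM; [apply: eqm_refl | apply: eqm_sym (nexp_eqm z0)].
rewrite cder_sum; case: M => [|M] // w ltM.
pose F i j := ((i.+1`!%:R^-1 : rat) *: iter i (adr z) (cder z) *
               ((j`!%:R^-1 : rat) *: z ^+ j)) w.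
have F0 i j : (M <= i + j)%N -> F i j = 0.
  move=> leM; rewrite /F -scalerAl ncs_scaleE -scalerAr ncs_scaleE.
  rewrite (@eqmM0 _ (i + 1) j) ?mulr0 //.
  - by apply: eqm_iter_adr => //; apply: cder0_eqm.
  - exact: eqmX0.
  by rewrite addn1 addSn (leq_trans ltM).
(* Since [cder z] has no constant term, F i j has order i + j + 1, so on w the terms of index M drop
   out and a square of side M remains. *)
transitivity (\sum_(i < M) \sum_(j < M) F i j); last first.
  rewrite mulr_suml ncs_sumE big_ord_recr /= mulr_sumr ncs_sumE.
  rewrite [X in _ = _ + X]big1 ?addr0 => [|j _]; last exact: (F0 M j (leq_addr _ _)).
  apply: eq_bigr => i _; rewrite mulr_sumr ncs_sumE big_ord_recr /=.
  by rewrite [X in _ = _ + X](F0 i M (leq_addl _ _)) addr0.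
rewrite sum_triangle // big_ord_recl /= cder1 scaler0 add0r ncs_sumE.
apply: eq_bigr => n _.
rewrite ncs_scaleE cderX sum_adr ncs_sumE mulr_sumr; apply: eq_bigr => i _.
case: i => i /=; rewrite /bump add1n subSS ltnS => le_in.
rewrite /F -scaler_nat -scalerAl -scalerAr !ncs_scaleE mulrA [RHS]mulrA.
(* The coefficients match because C(n+1, i+1) / (n+1)! = 1 / ((i+1)! (n-i)!). *)
congr (_ * _); have := bin_fact (le_in : (i.+1 <= n.+1)%N); rewrite subSS => <-.
rewrite !natrM invfM mulrAC mulVf ?mul1r ?invfM //.
by rewrite pnatr_eq0 -lt0n bin_gt0 ltnS.
Qed.

(* With [bernoulli_rec], x / (e^x - 1) inverts (e^{ad z} - 1) / ad z. *)
Lemma cder_nexp_bernoulli z y : z [::] = 0 -> eqm 1 y 0 ->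
    (forall M, eqm M (cder z) (\sum_(d < M) bernoulli d *: iter d (adr z) y)) ->
  cder (nexp z) = y * nexp z.
Proof.
move=> z0 y0 dz; apply: eqmP => M; apply: eqm_trans (cder_nexp z0) _.
apply: eqmM => //.
pose F i j : ncs T := ((i.+1`!%:R^-1 : rat) * bernoulli j) *: iter (i + j) (adr z) y.
apply: (@eqm_trans _ _ _ (\sum_(i < M) \sum_(j < M) F i j)).
  apply: eqm_sum => i _.
  have E : eqm M (iter i (adr z) (cder z))
      (iter i (adr z) (\sum_(d < M) bernoulli d *: iter d (adr z) y)).
    by elim: (nat_of_ord i) => //= k IH; apply: eqm_adr.
  move=> w ltM; rewrite ncs_scaleE E // iter_adr_sum -ncs_scaleE scaler_sumr.
  by congr (_ w); apply: eq_bigr => j _; rewrite scalerA /F iterD.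
move=> w ltM; rewrite ncs_sumE.
under eq_bigr => i _ do rewrite ncs_sumE.
rewrite (sum_triangle (F := fun i j => F i j w)) => [|i j leM]; last first.
  rewrite /F ncs_scaleE (@eqm_iter_adr 1 (i + j) z y) ?mulr0 //; first exact: eqm1.
  by rewrite addn1 ltnS ltnW ?(leq_trans ltM).
transitivity (\sum_(n < M) (n == 0 :> nat)%:R * iter n (adr z) y w).
  apply: eq_bigr => n _; rewrite -bernoulli_rec mulr_suml (reindex_inj rev_ord_inj).
  apply: eq_bigr => -[i /=]; rewrite ltnS subSS => le_in _.
  by rewrite subKn // /F ncs_scaleE subnK // [_^-1 * _]mulrC.
case: M ltM {F dz} => // M _; rewrite big_ord_recl big1 ?addr0 ?mul1r // => i _.
by rewrite mul0r.
Qed.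

(** At a word c w containing x the equation reads N f(c w) = [c = x] f(w), where N > 0 is the number
    of x in c w. Dividing by N determines f by induction from its values on words free of x. *)
Lemma cder_eq_uniq f g :
    cder f = nX x * f -> cder g = nX x * g ->
    (forall w, x \notin w -> f w = g w) ->
  f = g.
Proof.
move=> df dg fg; apply/funext => w.
elim: w => [|c w IH]; first exact: fg.
have [/fg//|] := boolP (x \notin c :: w); rewrite negbK => xw.
have E h : cder h = nX x * h -> (count_mem x (c :: w))%:R * h (c :: w) = (c == x)%:R * h w.
  move=> dh; rewrite -cderE dh ncs_mul_cons {1}/nX {1}/ncX mul0r add0r /ncder.
  rewrite (_ : (fun _ => _) = (c == x)%:R *: (1 : ncs T)) -?scalerAl ?mul1r //.
  by apply/funext => v; rewrite ncs_scaleE /nX /ncX eqseq_cons -natrM mulnb.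
apply: (@mulfI _ ((count_mem x (c :: w))%:R : rat)).
  by rewrite pnatr_eq0 -lt0n -has_count has_pred1.
by rewrite !E // IH.
Qed.

Definition agree_free f g := forall w, x \notin w -> f w = g w.

Lemma agreeM f f' g g' :
  agree_free f f' -> agree_free g g' -> agree_free (f * g) (f' * g').
Proof.
move=> ff gg w; rewrite !ncs_mulE => xw; apply: eq_bigr => i _.
move: xw; rewrite -{1}(cat_take_drop i w) mem_cat negb_or => /andP[xt xd].
by rewrite ff ?gg.
Qed.

Lemma agree_nexp f g : agree_free f g -> agree_free (nexp f) (nexp g).
Proof.
move=> fg w xw; have fgX n : agree_free (f ^+ n) (g ^+ n).
  by elim: n => // n IH; rewrite !exprS; apply: agreeM.
by apply: eq_bigr => i _; rewrite !ncpowE fgX.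
Qed.

Lemma nexp0 : nexp (0 : ncs T) = 1.
Proof.
apply/funext => w; rewrite /nexp /ncexp big_ord_recl big1 ?addr0 ?divr1 // => i _.
by rewrite ncpowE exprS mul0r mul0r.
Qed.

Lemma nexp_mul_bernoulli z z0 : z [::] = 0 -> z0 [::] = 0 -> cder z0 = 0 ->
    agree_free z z0 ->
    (forall M, eqm M (cder z) (\sum_(d < M) bernoulli d *: iter d (adr z) (nX x))) ->
  nexp z = nexp (nX x) * nexp z0.
Proof.
move=> z_nil z0_nil dz0 zz0 dz; have x1 : eqm 1 (nX x) 0 by case.
apply: cder_eq_uniq => [||]; first exact: cder_nexp_bernoulli.
  rewrite cderM [cder (nexp z0)](_ : _ = 0) ?mulr0 ?addr0; last first.
    apply: eqmP => M; apply: eqm_trans (cder_nexp z0_nil) _.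
    rewrite dz0 big1 ?mul0r // => i _.
    by rewrite iter_adr0 scaler0.
  (* The letter itself satisfies the Bernoulli equation with z = y = x: as [x, x] = 0, only the term
     d = 0 survives, and b_0 = 1. *)
  rewrite mulrA; congr (_ * _); apply: cder_nexp_bernoulli => // M.
  case: M => // M; rewrite big_ord_recl big1 ?addr0 => [|i _]; last first.
    by rewrite lift0 iterSr [X in iter _ _ X]subrr iter_adr0 scaler0.
  rewrite bernoulli0 scale1r => w _; rewrite cderE /nX /ncX; case: eqP => [->|/eqP/negPf].
    by rewrite /= !eqxx mulr1.
  by rewrite /= mulr0 => ->.
move=> w xw; rewrite (agree_nexp zz0) // -[nexp z0 in LHS]mul1r.
apply: agreeM (xw) => // v xv; rewrite -nexp0; apply: agree_nexp (xv) => u xu.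
by rewrite /nX /ncX; case: eqP xu => // ->; rewrite mem_seq1 eqxx.
Qed.
End Derivation.

(** * Posetted trees by recursion on the spine *)

Section Structural.
Variable A : Type.
Implicit Types (t l r : ltree A) (s : seq bool).

Fixpoint leaves t : seq A :=
  match t with Leaf a => [:: a] | Node l r => leaves l ++ leaves r end.

(** With v the root, this is f(m(v)) and [spine_dist] is d(v); other vertices are reached through
    [subtree]. *)
Fixpoint spine_label t : A :=
  match t with Leaf a => a | Node _ r => spine_label r end.

Fixpoint spine_dist t : nat :=
  match t with Leaf _ => 0 | Node _ r => (spine_dist r).+1 end.

Fixpoint subtree t s : ltree A :=
  match t, s with
  | Node l r, c :: s' => subtree (if c then r else l) s'
  | _, _ => t
  end.

Fixpoint internal t s : bool :=
  match t, s with
  | Leaf _, _ => false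
  | Node _ _, [::] => true
  | Node l r, c :: s' => internal (if c then r else l) s'
  end.

(* The address of the vertex nearest to the root on the rightmost branch of s. *)
Fixpoint strip s : seq bool :=
  if s is c :: s' then if all id s then [::] else c :: strip s' else [::].

Lemma nil_vertex t : [::] \in vertices t.
Proof. by case: t => //= l r; rewrite inE eqxx. Qed.

Lemma cons_vertex l r c s :
  (c :: s \in vertices (Node l r)) = (s \in vertices (if c then r else l)).
Proof.
have inj (b : bool) : injective (cons b) by move=> ? ? [].
rewrite inE /= mem_cat; case: c; rewrite (mem_map (inj _)); last first.
  by rewrite [X in _ || X](_ : _ = false) ?orbF //; apply/negP => /mapP[].
by rewrite [X in X || _](_ : _ = false) //; apply/negP => /mapP[].
Qed.

Lemma rcons_vertex t s c : (rcons s c \in vertices t) = internal t s.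
Proof.
elim: t s => [a|l IHl r IHr] [|b s] //=; rewrite ?cons_vertex ?nil_vertex //.
by case: b.
Qed.

Lemma uniq_vertices t : uniq (vertices t).
Proof.
have inj (b : bool) : injective (cons b) by move=> ? ? [].
elim: t => //= l IHl r IHr; rewrite mem_cat cat_uniq !map_inj_uniq // IHl IHr.
rewrite andbT; apply/and3P; split => //.
  by apply/norP; split; apply/negP => /mapP[].
by apply/hasPn => _ /mapP[s _ ->]; apply/negP => /mapP[].
Qed.

Lemma prefix_vertex t s s' : s ++ s' \in vertices t -> s \in vertices t.
Proof.
elim: s' s => [|c s' IH] s; first by rewrite cats0.
rewrite -cat_rcons => /IH; rewrite rcons_vertex.
elim: t s {IH} => [a|l IHl r IHr] [|b s] //= it; rewrite ?nil_vertex // cons_vertex.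
by case: b it => [/IHr|/IHl].
Qed.

Lemma strip_rcons s : strip (rcons s true) = strip s.
Proof. by elim: s => //= -[] s ->; rewrite all_rcons. Qed.

Lemma strip_cat s : exists k, s = strip s ++ nseq k true.
Proof.
elim: s => [|c s [k IH]] /=; first by exists 0%N.
case: ifP => [/andP[-> alls]|_]; last by exists k; rewrite /= -IH.
by exists (size s).+1; congr (_ :: _); apply/all_pred1P; apply: sub_all alls => -[].
Qed.

Lemma strip_nseq s k : strip (s ++ nseq k true) = strip s.
Proof.
elim: k s => [|k IH] s; first by rewrite cats0.
by rewrite -cat_rcons IH strip_rcons.
Qed.

Lemma vertex_cat t s s' : s \in vertices t ->
  (s ++ s' \in vertices t) = (s' \in vertices (subtree t s)).
Proof.
elim: t s => [a|l IHl r IHr] [|c s] //; rewrite !cons_vertex /=.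
by case: c => [/IHr|/IHl].
Qed.

Lemma internal_cat t s s' : s \in vertices t ->
  internal t (s ++ s') = internal (subtree t s) s'.
Proof.
elim: t s => [a|l IHl r IHr] [|c s] //; rewrite !cons_vertex /=.
by case: c => [/IHr|/IHl].
Qed.

Lemma label_at_cat t s s' : s \in vertices t ->
  label_at t (s ++ s') = label_at (subtree t s) s'.
Proof.
elim: t s => [a|l IHl r IHr] [|c s] //; rewrite !cons_vertex /=.
by case: c => [/IHr|/IHl].
Qed.

Lemma spine_leafP t (m := nseq (spine_dist t) true) :
  [/\ m \in vertices t, ~~ internal t m & label_at t m = spine_label t].
Proof.
by rewrite {}/m; elim: t => //= l _ r [mt im em]; split; rewrite ?cons_vertex.
Qed.

(** Turns a condition on the leaves u -> v, as occurs in t(v) and in the order on leaves, into one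
    on a list of labels. *)
Lemma leaves_subtree t s : s \in vertices t ->
  [seq label_at t u | u <- vertices t & ~~ internal t u && prefix s u]
  = leaves (subtree t s).
Proof.
have E : forall t', [seq label_at t' u | u <- vertices t' & ~~ internal t' u] = leaves t'.
  elim=> //= l IHl r IHr; rewrite filter_cat map_cat !filter_map -!map_comp.
  by rewrite -IHl -IHr.
elim: t s => [a|l IHl r IHr] [|c s] //.
  by move=> _; rewrite -E; congr map; apply: eq_filter => u; rewrite prefix0s andbT.
rewrite cons_vertex /= => sc; rewrite filter_cat map_cat !filter_map -!map_comp /=.
case: c sc => [/IHr <-|/IHl <-] /=.
  rewrite [X in map _ X](_ : _ = [::]) //=.
  by rewrite (eq_filter (a2 := pred0)) ?filter_pred0 // => u /=; rewrite andbF.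
rewrite [X in _ ++ map _ X](_ : _ = [::]) ?cats0 //=.
by rewrite (eq_filter (a2 := pred0)) ?filter_pred0 // => u /=; rewrite andbF.
Qed.

Section Fold.
Variables (R : Type) (idx : R) (op : Monoid.com_law idx) (F : ltree A -> R).

(* The left children along the spine are the roots of the subtrees that contain
   the subroots other than the root. *)
Fixpoint spine_fold t : R :=
  if t is Node l r then op (op (F l) (spine_fold l)) (spine_fold r) else idx.

(** The root of a left child starts a new branch, while the root of a right child continues the
    spine: the left subtree contributes all its subroots, the right one all but its root. The
    hypothesis on leaves is there because a leaf is not a subroot. The law [op] is the product for
    the coefficients and conjunction for monotonicity. *)
Lemma big_subroots t : (forall a, F (Leaf a) = idx) ->
  \big[op/idx]_(s <- vertices t | internal t s && (strip s == s)) F (subtree t s)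
  = op (F t) (spine_fold t).
Proof.
move=> F1.
have E t' : op (F t') (\big[op/idx]_(s <- vertices t' |
      [&& internal t' s, strip s == s & s != [::]]) F (subtree t' s)) =
    \big[op/idx]_(s <- vertices t' | internal t' s && (strip s == s)) F (subtree t' s).
  case: t' => [a|l r]; first by rewrite /= F1 !big_cons !big_nil /= Monoid.mulm1.
  rewrite [vertices _]/= !big_cons /=; congr (op _ _).
  rewrite !big_cat !big_map /=; congr (op _ _); apply: eq_bigl => s.
    by rewrite andbT.
  by rewrite andbT.
rewrite -E; congr (op _ _); elim: t => [a|l IHl r IHr] /=.
  by rewrite big_cons big_nil.
rewrite big_cons /= big_cat !big_map /= -IHl -IHr E; congr (op _ _).
  by apply: eq_bigl => s; rewrite eqseq_cons /= andbT.
apply: eq_bigl => s /=; congr (_ && _); rewrite andbT.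
case: ifPn => [alls|nalls]; last first.
  by rewrite eqseq_cons /=; case: s nalls => [|c s] //= _; rewrite andbT.
by case: s alls => [|c s] //= ->.
Qed.
End Fold.
End Structural.

(** * Branches and subroots read off from addresses *)

Section Vertices.
Variables (A : Type) (t : ltree A).
Implicit Types u v : vertex t.

Lemma vertexP v : val v \in vertices t.
Proof. exact: ssvalP. Qed.

Lemma perm_vertices : perm_eq [seq val v | v <- index_enum (vertex t)] (vertices t).
Proof.
apply: uniq_perm; rewrite ?uniq_vertices ?(map_inj_uniq val_inj) ?index_enum_uniq //.
move=> s; apply/mapP/idP => [[v _ ->]|sv]; first exact: vertexP.
by exists (SeqSub sv); rewrite ?mem_index_enum.
Qed.

Lemma big_vertex (R : Type) (idx : R) (op : Monoid.com_law idx)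
    (P : pred (seq bool)) (F : seq bool -> R) :
  \big[op/idx]_(v : vertex t | P (val v)) F (val v) =
  \big[op/idx]_(s <- vertices t | P s) F s.
Proof. by rewrite -(perm_big _ perm_vertices) big_map. Qed.

Lemma is_leafE v : is_leaf v = ~~ internal t (val v).
Proof.
apply/forallP/idP => [leafv|int u].
  apply/negP => int; have sv : rcons (val v) true \in vertices t by rewrite rcons_vertex.
  by have /existsPn/(_ true)/eqP := leafv (SeqSub sv).
apply/existsPn => c; apply: contra int => /eqP E.
by rewrite -(rcons_vertex _ _ c) -E; apply: vertexP.
Qed.

Lemma strip_vertex v : strip (val v) \in vertices t.
Proof.
have [k Ek] := strip_cat (val v).
by apply: (prefix_vertex (s' := nseq k true)); rewrite -Ek vertexP.
Qed.

(** A right edge appends a [true], which [strip] forgets, so [strip] is constant on a branch;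
    conversely right edges join each vertex to its stripped address. *)
Lemma branchE u v : (u \in branch v) = (strip (val u) == strip (val v)).
Proof.
pose e := [rel x y : vertex t | right_edge x y || right_edge y x].
have strip_e x y : e x y -> strip (val x) = strip (val y).
  by case/orP => /eqP ->; rewrite strip_rcons.
have sym : connect_sym e.
  by apply: sym_connect_sym => x y; rewrite /e /= orbC.
rewrite inE -[connect _ _ _]/(connect e v u); apply/connectP/eqP.
  case=> p; elim: p v => [|x p IH] v /=; first by move=> _ ->.
  by case/andP=> /strip_e -> /IH/[apply].
move=> Euv; apply/connectP.
have to_strip x : connect e x (SeqSub (strip_vertex x)).
  have [k] := strip_cat (val x).
  have : val (SeqSub (strip_vertex x)) = strip (val x) by [].
  move: (SeqSub _) => y; move: (strip _) => s0 Ey; case: x => s sv /= Es.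
  elim: k s sv Es => [|k IH] s sv Es.
    by rewrite (_ : SeqSub sv = y) ?connect0 //; apply: val_inj; rewrite Ey /= Es cats0.
  have Es' : s = rcons (s0 ++ nseq k true) true.
    by rewrite Es rcons_cat -(addn1 k) nseqD cats1.
  have s'v : s0 ++ nseq k true \in vertices t.
    by apply: (prefix_vertex (s' := [:: true])); rewrite cats1 -Es'.
  apply: connect_trans (IH _ s'v erefl); apply: connect1.
  by apply/orP; left; apply/eqP.
apply: connect_trans (to_strip v) _; rewrite sym.
have -> : SeqSub (strip_vertex v) = SeqSub (strip_vertex u) by apply: val_inj.
exact: to_strip.
Qed.

(** Leaves of one branch have addresses differing only by the number of trailing [true]; the shorter
    of two distinct ones would have a right child. So the leaf picked is the one at the end of the
    spine. *)
Lemma branch_leafE v :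
  val (branch_leaf v) = val v ++ nseq (spine_dist (subtree t (val v))) true.
Proof.
have sv := vertexP v; set m := nseq _ _.
have [mt nim _] := spine_leafP (subtree t (val v)).
have mv : val v ++ m \in vertices t by rewrite vertex_cat.
pose l := SeqSub mv.
have strip_l : strip (val l) = strip (val v) by rewrite strip_nseq.
have int_l : ~~ internal t (val l) by rewrite /= internal_cat.
rewrite /branch_leaf; case: pickP => [l'|/(_ l)]; last first.
  by rewrite is_leafE int_l branchE strip_l eqxx.
rewrite is_leafE branchE => /andP[int_l' /eqP strip_l'] /=; rewrite -[RHS]/(val l).
have [k Ek] := strip_cat (val l); have [k' Ek'] := strip_cat (val l').
have ltF (x y : vertex t) i j : ~~ internal t (val x) ->
    val x = strip (val v) ++ nseq i true -> val y = strip (val v) ++ nseq j true ->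
    ~~ (i < j)%N.
  move=> intx Ex Ey; apply: contra intx => lt_ij.
  rewrite -(rcons_vertex _ _ true); apply: (prefix_vertex (s' := nseq (j - i.+1) true)).
  rewrite Ex rcons_cat -(_ : nseq i.+1 true = rcons (nseq i true) true).
    by rewrite -catA -nseqD subnKC // -Ey vertexP.
  by rewrite -addn1 nseqD cats1.
rewrite strip_l in Ek; rewrite strip_l' in Ek'.
have := ltF _ _ _ _ int_l Ek Ek'; have := ltF _ _ _ _ int_l' Ek' Ek.
by rewrite -!leqNgt => le1 le2; rewrite Ek Ek' (@anti_leq k k') // le1 le2.
Qed.

Lemma branch_distE v : branch_dist v = spine_dist (subtree t (val v)).
Proof.
by rewrite /branch_dist /depth branch_leafE size_cat size_nseq addnC addnK.
Qed.

Lemma label_branch_leaf v : label (branch_leaf v) = spine_label (subtree t (val v)).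
Proof.
rewrite /label branch_leafE label_at_cat ?vertexP //.
by have [] := spine_leafP (subtree t (val v)).
Qed.

Lemma size_strip s : (size (strip s) <= size s)%N.
Proof. by have [k Ek] := strip_cat s; rewrite [X in (_ <= size X)%N]Ek size_cat leq_addr. Qed.

(** Being fixed by [strip] means being the top of the branch. The branch is then non trivial exactly
    when v has a right child, that is when v is internal. *)
Lemma subrootsE v :
  (v \in subroots t) = internal t (val v) && (strip (val v) == val v).
Proof.
rewrite inE; have [sv|nsv] /= := boolP (strip (val v) == val v); last first.
  rewrite andbF; apply/negP => /andP[_ /forallP/(_ (SeqSub (strip_vertex v)))].
  have [k Ek] := strip_cat (val v).
  have strip2 : strip (strip (val v)) = strip (val v) by rewrite {2}Ek strip_nseq.
  rewrite branchE strip2 eqxx /depth /= {1}Ek size_cat size_nseq.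
  case: k Ek => [|k] Ek; first by rewrite Ek cats0 strip2 eqxx in nsv.
  by rewrite -[leqRHS]addn0 leq_add2l.
rewrite andbT; have -> /= : [forall u in branch v, (depth v <= depth u)%N].
  apply/forall_inP => u; rewrite branchE (eqP sv) /depth => /eqP <-.
  exact: size_strip.
rewrite andbT; have vb : v \in branch v by rewrite branchE.
apply/idP/idP => [|int]; last first.
  have s'v : rcons (val v) true \in vertices t by rewrite rcons_vertex.
  have ub : SeqSub s'v \in branch v by rewrite branchE /= strip_rcons.
  rewrite (cardsD1 v) vb add1n ltnS card_gt0; apply/set0Pn; exists (SeqSub s'v).
  rewrite in_setD1 ub andbT.
  by apply/eqP => /(congr1 (size \o val)) /= /eqP; rewrite size_rcons eqn_leq ltnn.
apply: contraLR => nint; rewrite -leqNgt (cardsD1 v) vb add1n ltnS leqn0 cards_eq0.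
apply/eqP/setP => u; rewrite in_setD1 finset.in_set0 branchE (eqP sv).
apply/negP => /andP[neq_uv /eqP Eu]; have [k Ek] := strip_cat (val u).
case: k Ek => [|k]; rewrite Eu ?cats0 => Ek.
  by case/eqP: neq_uv; apply: val_inj.
have : rcons (val v) true ++ nseq k true \in vertices t by rewrite cat_rcons -Ek vertexP.
by move/prefix_vertex; rewrite rcons_vertex (negPf nint).
Qed.

Lemma leaf_multE (B : eqType) (f : A -> B) v b :
  #|[set u : vertex t | [&& is_leaf u, below u v & f (label u) == b]]| =
  count_mem b (map f (leaves (subtree t (val v)))).
Proof.
rewrite -leaves_subtree ?vertexP // -map_comp count_map count_filter -sum1_count -sum1_card.
rewrite -big_vertex; apply: eq_bigl => u; rewrite !inE is_leafE /below /label /=.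
by rewrite andbA andbC.
Qed.
End Vertices.

Definition root_coef (A : eqType) (t : ltree A) : rat :=
  bernoulli (spine_dist t) / (count_mem (spine_label t) (leaves t))%:R.

Definition spine_coef (A : eqType) (t : ltree A) : rat :=
  spine_fold ( *%R : Monoid.com_law (1 : rat)) (@root_coef A) t.

Lemma tree_coefE (A : eqType) (t : ltree A) :
  tree_coef t = root_coef t * spine_coef t.
Proof.
rewrite /tree_coef /spine_coef -big_subroots; last first.
  by move=> a; rewrite /root_coef /= eqxx bernoulli0 divr1.
rewrite -big_vertex; apply: eq_big => [v|v _]; first by rewrite subrootsE.
rewrite branch_distE /root_coef; congr (_ / _%:R).
rewrite /leaf_mult label_branch_leaf.
by have := leaf_multE id v (spine_label (subtree t (val v))); rewrite map_id.
Qed.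

Section Posetted.
Variables (d : Order.disp_t) (A : porderType d).
Implicit Types t : ltree A.

Definition root_ok t : bool := all (fun a => a <= spine_label t)%O (leaves t).

Definition spine_ok t : bool := spine_fold (andb : Monoid.com_law true) root_ok t.

(** Every non trivial relation in the order on leaves comes from a subroot v, comparing a leaf above
    v with m(v). Monotonicity is thus one condition per subroot and splits along the spine just as
    the coefficient does. *)
Lemma posettedE t : posetted t = root_ok t && spine_ok t.
Proof.
rewrite /spine_ok -big_subroots; last by move=> a; rewrite /root_ok /= lexx.
rewrite -big_vertex big_andE; apply/idP/forall_inP.
  move=> /forallP post v /andP[int_v sv]; apply/allP => a.
  rewrite -leaves_subtree ?vertexP // => /mapP[s].
  rewrite mem_filter => /andP[/andP[nint_s pre_s] ts] ->.
  have /forallP/(_ (branch_leaf v)) := post (SeqSub ts).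
  rewrite label_branch_leaf => /implyP; apply; rewrite !is_leafE nint_s /=.
  rewrite branch_leafE internal_cat ?vertexP //.
  have [_ -> _] /= := spine_leafP (subtree t (val v)).
  rewrite /leaf_le; apply/orP; right; apply/exists_inP; exists v.
    by rewrite subrootsE int_v.
  by rewrite eqxx.
move=> ok; apply/forallP => l1; apply/forallP => l2; apply/implyP.
case/and3P => leaf1 leaf2 /orP[/eqP->|/exists_inP[v]]; first by [].
rewrite subrootsE => /ok /allP okv /andP[/eqP-> l1v]; rewrite label_branch_leaf.
apply: okv; rewrite -leaves_subtree ?vertexP //; apply/mapP; exists (val l1) => //.
by rewrite mem_filter vertexP -is_leafE leaf1 andbT.
Qed.
End Posetted.

(** * The series of a chain of labels *)

(** The indices i = 0 and i = n contribute nothing, no tree having zero leaves; keeping them gives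
    the sum the shape of a product of series. *)
Lemma sum_ltrees (V : nmodType) (A : finType) (F : ltree A -> V) n :
  \sum_(t <- ltrees A n) F t =
  \sum_(a | n == 1%N) F (Leaf a) +
  \sum_(i < n.+1) \sum_(l <- ltrees A i) \sum_(r <- ltrees A (n - i)) F (Node l r).
Proof.
have fuelE (G : ltree A -> V) f m : (m <= f)%N ->
    \sum_(t <- ltrees_rec A f m) G t = \sum_(t <- ltrees A m) G t.
  move=> le_mf; apply: perm_big; apply: uniq_perm.
  - exact: uniq_ltrees_rec.
  - exact: uniq_ltrees.
  by move=> t; rewrite mem_ltrees_rec // mem_ltrees.
case: n => [|n].
  by rewrite big_nil big_pred0 // big_ord_recl big_ord0 big_nil !addr0.
rewrite /ltrees /= big_cat big_flatten big_map; congr (_ + _).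
  by case: (n.+1 == 1%N); [rewrite big_map big_enum | rewrite big_nil big_pred0].
rewrite big_ord_recl big_nil add0r big_ord_recr /= subnn.
rewrite [X in _ = _ + X]big1 ?addr0 => [|l _]; last by rewrite big_nil.
rewrite -[1%N]addn0 iotaDl big_map -val_enum_ord big_map big_enum.
apply: eq_bigr => i _; rewrite big_allpairs_dep fuelE 1?ltn_ord //.
by apply: eq_bigr => l _; rewrite fuelE // add1n subSS leq_subr.
Qed.

(** * Series with prescribed coefficients on trees *)

Section TreeSeries.
Variable A : finType.
Implicit Types (t l r : ltree A) (w : seq A) (phi psi : ltree A -> rat).

Fixpoint tree_nc t : ncs A :=
  match t with
  | Leaf a => nX a
  | Node l r => adr (tree_nc l) (tree_nc r)
  end.

Lemma tree_nc_perm t w : tree_nc t w != 0 -> perm_eq w (leaves t).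
Proof.
elim: t w => [a|l IHl r IHr] w /=.
  by rewrite /nX /ncX pnatr_eq0 eqb0 negbK => /eqP ->.
have mul0 (f g : ncs A) s s' : (forall v, f v != 0 -> perm_eq v s) ->
    (forall v, g v != 0 -> perm_eq v s') -> (f * g) w != 0 -> perm_eq w (s ++ s').
  move=> fs gs; apply: contraR => nperm; rewrite ncs_mulE big1 // => i _.
  apply/eqP; rewrite mulf_eq0; apply: contraR nperm; rewrite negb_or => /andP[/fs fi /gs gi].
  by rewrite -(cat_take_drop i w); apply: perm_cat.
rewrite /adr ncs_subE; have [->|nz _] := eqVneq ((tree_nc l * tree_nc r) w) 0.
  by rewrite sub0r oppr_eq0 perm_sym perm_catC perm_sym; apply: mul0.
exact: (mul0 (tree_nc l) (tree_nc r)).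
Qed.

Lemma size_leaves t : size (leaves t) = nleaves t.
Proof. by elim: t => //= l IHl r IHr; rewrite size_cat IHl IHr. Qed.

Lemma tree_nc_size t w : size w != nleaves t -> tree_nc t w = 0.
Proof.
by move=> szw; apply: contraNeq szw => /tree_nc_perm/perm_size; rewrite size_leaves => ->.
Qed.

(** A tree with n leaves is homogeneous of degree n, so the sum over all trees is finite at each
    word. *)
Definition tree_series phi : ncs A :=
  fun w => \sum_(t <- ltrees A (size w)) phi t * tree_nc t w.

Lemma eqm_tree_series M phi psi :
    (forall t, (nleaves t < M)%N -> phi t = psi t) ->
  eqm M (tree_series phi) (tree_series psi).
Proof.
move=> E w ltM; apply: eq_big_seq => t; rewrite mem_ltrees => /eqP szt.
by rewrite E // szt.
Qed.

Lemma tree_series_sum (I : Type) (s : seq I) (P : pred I) (a : I -> rat)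
    (phi : I -> ltree A -> rat) :
  tree_series (fun t => \sum_(i <- s | P i) a i * phi i t) =
  \sum_(i <- s | P i) a i *: tree_series (phi i).
Proof.
apply/funext => w; rewrite ncs_sumE.
under [RHS]eq_bigr => i _ do rewrite ncs_scaleE mulr_sumr.
rewrite exchange_big; apply: eq_bigr => t _; rewrite mulr_suml.
by apply: eq_bigr => i _; rewrite mulrA.
Qed.

Lemma tree_series_mul phi psi w :
  (tree_series phi * tree_series psi) w =
  \sum_(i < (size w).+1) \sum_(l <- ltrees A i) \sum_(r <- ltrees A (size w - i))
     phi l * psi r * (tree_nc l * tree_nc r) w.
Proof.
rewrite ncs_mulE; apply: eq_bigr => i _.
have szt : size (take i w) = i by rewrite size_takel // -ltnS.
rewrite /tree_series szt size_drop mulr_suml; apply: eq_big_seq => l.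
rewrite mem_ltrees => /eqP szl; rewrite mulr_sumr; apply: eq_big_seq => r _.
rewrite ncs_mulE (bigD1 i) //= big1 ?addr0 => [|j neq_ji]; first by rewrite mulrACA.
rewrite tree_nc_size ?mul0r // szl size_takel //; last by rewrite -ltnS.
Qed.

(** A coefficient that is multiplicative at the root and zero on leaves corresponds to a bracket: a
    tree [Node l r] is a free choice of l and r, as in a product of two sums. *)
Lemma tree_series_adr phi psi chi :
    (forall a, chi (Leaf a) = 0) ->
    (forall l r, chi (Node l r) = phi l * psi r) ->
  tree_series chi = adr (tree_series phi) (tree_series psi).
Proof.
move=> chi0 chi2; apply/funext => w; rewrite /adr ncs_subE !tree_series_mul.
rewrite {1}/tree_series sum_ltrees big1 ?add0r => [|a _]; last by rewrite chi0 mul0r.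
(* In the second product the right subtree comes first, so the degrees are reversed before the two
   products are subtracted termwise. *)
rewrite [X in _ = _ - X](reindex_inj rev_ord_inj) -sumrB /=; apply: eq_bigr => i _.
have le_in : (i <= size w)%N by rewrite -ltnS.
rewrite subSS subKn // [X in _ = _ - X]exchange_big -sumrB /=.
apply: eq_bigr => l _; rewrite -sumrB; apply: eq_bigr => r _.
by rewrite chi2 /= /adr ncs_subE mulrBr [psi r * _]mulrC.
Qed.

Lemma tree_series_leaf a :
  tree_series (fun t => if t is Leaf b then (b == a)%:R else 0) = nX a.
Proof.
apply/funext => w; rewrite /tree_series sum_ltrees.
rewrite [X in _ + X]big1 ?addr0 => [|i _]; last first.
  by rewrite big1 // => l _; rewrite big1 // => r _; rewrite mul0r.
rewrite big_mkcond (bigD1 a) //= big1 ?addr0 => [|b /negPf neq_ba].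
  rewrite eqxx mul1r; case: eqP => // szw; rewrite /nX /ncX.
  by case: eqP => // Ew; case: szw; rewrite Ew.
by rewrite neq_ba mul0r if_same.
Qed.

(** All words occurring in a tree are rearrangements of its leaf labels, so each tree is an
    eigenvector of the derivation. *)
Lemma cder_tree_series x phi :
  cder x (tree_series phi) =
  tree_series (fun t => (count_mem x (leaves t))%:R * phi t).
Proof.
apply/funext => w; rewrite cderE mulr_sumr; apply: eq_bigr => t _.
have [->|/tree_nc_perm/permP->] := eqVneq (tree_nc t w) 0; first by rewrite !mulr0.
by rewrite mulrA.
Qed.

Lemma tree_series_nil phi : tree_series phi [::] = 0.
Proof. by rewrite /tree_series big_nil. Qed.
End TreeSeries.

Section Chain.
Variable k : nat.
Implicit Types (t l r : ltree 'I_k) (x : 'I_k).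

(* Under [root_ok] the spine label is the largest one: the labels are below j. *)
Definition chain_coef j t : rat :=
  if [&& root_ok t, spine_ok t & (spine_label t < j)%N]
  then root_coef t * spine_coef t else 0.

Definition chain_series j : ncs 'I_k := tree_series (chain_coef j).

(* The factor of the root is left out; derivation with respect to x turns it into
   [bernoulli d]. *)
Definition spine_weight x d t : rat :=
  if [&& spine_label t == x, spine_dist t == d, spine_ok t &
         all (fun a => a <= x)%O (leaves t)]
  then spine_coef t else 0.

Lemma mem_spine_label (A : eqType) (t : ltree A) : spine_label t \in leaves t.
Proof. by elim: t => /= [a|l _ r IH]; rewrite ?mem_seq1 // mem_cat IH orbT. Qed.

Lemma spine_dist_lt (A : finType) (t : ltree A) : (spine_dist t < nleaves t)%N.
Proof.
by elim: t => //= l _ r IH; rewrite -add1n leq_add ?nleaves_gt0.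
Qed.

Lemma spine_weight_leaf x a : spine_weight x 0 (Leaf a) = (a == x)%:R.
Proof. by rewrite /spine_weight /= andbT; case: eqP => // ->; rewrite lexx. Qed.

Lemma all_le_root_ok x t : root_ok t ->
  all (fun a => a <= x)%O (leaves t) = (spine_label t < x.+1)%N.
Proof.
move=> /allP ok; rewrite ltnS; apply/allP/idP => [/(_ _ (mem_spine_label t)) //|le_x a].
by move=> /ok le_a; apply: le_trans le_a _.
Qed.

Lemma spine_weight_node x d l r :
  spine_weight x d.+1 (Node l r) = chain_coef x.+1 l * spine_weight x d r.
Proof.
rewrite /spine_weight /chain_coef /= eqSS all_cat /spine_ok /spine_coef /=.
case: (spine_label r == x) (spine_dist r == d) => [] [] //=; rewrite ?mulr0 //.
have [okl|] := boolP (root_ok l); rewrite /= ?mul0r // all_le_root_ok //.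
case: (spine_fold _ _ l); rewrite /= ?mul0r //.
by case: (_ < _)%N; rewrite /= ?andbF ?mul0r //; case: ifP; rewrite ?mulr0.
Qed.

(** A tree with d spine edges ending in x is [T_1, [T_2, ... [T_d, x]]], where the T_i are
    independent posetted trees with labels at most x, that is below x + 1. *)
Lemma spine_series x d :
  tree_series (spine_weight x d) = iter d (adr (chain_series x.+1)) (nX x).
Proof.
elim: d => [|d IH] /=.
  rewrite -tree_series_leaf; congr tree_series; apply/funext => -[a|l r].
    exact: spine_weight_leaf.
  by rewrite /spine_weight /= andbF.
rewrite -IH; apply: tree_series_adr => [a|l r]; last exact: spine_weight_node.
by rewrite /spine_weight /= andbF.
Qed.

Lemma count_small x t : root_ok t -> (spine_label t < x)%N -> count_mem x (leaves t) = 0%N.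
Proof.
move=> /allP ok lt_x; apply/eqP; rewrite -leqn0 leqNgt -has_count has_pred1.
by apply/negP => /ok; rewrite leEord leqNgt lt_x.
Qed.

(** For a tree with spine label x, the eigenvalue is the number of leaves labelled x, which is t at
    the root, and cancels it. A smaller spine label bounds all labels below x, so the derivation
    kills the tree. *)
Lemma chain_derivation x M :
  eqm M (cder x (chain_series x.+1))
        (\sum_(d < M) bernoulli d *: iter d (adr (chain_series x.+1)) (nX x)).
Proof.
under eq_bigr => d _ do rewrite -spine_series.
rewrite -tree_series_sum cder_tree_series; apply: eqm_tree_series => t lt_tM.
have lt_dM : (spine_dist t < M)%N by rewrite (leq_trans (spine_dist_lt t)) // ltnW.
rewrite (bigD1 (Ordinal lt_dM)) //= big1 ?addr0 => [|d]; last first.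
  rewrite -val_eqE /= eq_sym => /negPf neq_d.
  by rewrite /spine_weight neq_d andbF mulr0.
rewrite /chain_coef /spine_weight eqxx /=.
have [Ex|neq_x] /= := eqVneq (spine_label t) x.
  rewrite Ex ltnSn andbT andbC /root_ok Ex; case: ifP => _; rewrite ?mulr0 //.
  rewrite /root_coef Ex mulrA mulrC [X in _ * X]mulrC divfK 1?mulrC //.
  by rewrite pnatr_eq0 -lt0n -has_count has_pred1 -Ex mem_spine_label.
rewrite mulr0; case: ifP => [|_]; last by rewrite mulr0.
case/and3P => ok _; rewrite ltnS leq_eqVlt val_eqE (negPf neq_x) /= => lt_x.
by rewrite count_small // mul0r.
Qed.

Lemma cder_chain x : cder x (chain_series x) = 0.
Proof.
rewrite cder_tree_series; apply/funext => w; apply: big1 => t _.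
rewrite /chain_coef; case: ifP => [/and3P[ok _ lt_x]|_]; last by rewrite mulr0 mul0r.
by rewrite count_small // !mul0r.
Qed.

(** The trees counted on the left only have spine label x, hence live on words containing x. *)
Lemma agree_chain x : agree_free x (chain_series x.+1) (chain_series x).
Proof.
move=> w xw; apply: eq_bigr => t _.
have [->|/tree_nc_perm pw] := eqVneq (tree_nc t w) 0; first by rewrite !mulr0.
rewrite /chain_coef ltnS leq_eqVlt val_eqE; case: eqP => // Ex.
by move: xw; rewrite (perm_mem pw) -Ex mem_spine_label.
Qed.

Lemma nexp_chainS x :
  nexp (chain_series x.+1) = nexp (nX x) * nexp (chain_series x).
Proof.
apply: nexp_mul_bernoulli.
- exact: tree_series_nil.
- exact: tree_series_nil.
- exact: cder_chain.
- exact: agree_chain.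
exact: chain_derivation.
Qed.

Lemma nexp_chain : nexp (chain_series k) = \prod_(x <- rev (enum 'I_k)) nexp (nX x).
Proof.
suff E m : (m <= k)%N ->
    nexp (chain_series m) = \prod_(x <- rev (take m (enum 'I_k))) nexp (nX x).
  by rewrite E // take_oversize // size_enum_ord.
elim: m => [|m IH] lt_mk.
  rewrite take0 big_nil -nexp0; congr nexp; apply/funext => w.
  by apply: big1 => t _; rewrite /chain_coef !andbF mul0r.
rewrite (take_nth (Ordinal lt_mk)) ?size_enum_ord // rev_rcons big_cons.
rewrite -IH ?(ltnW lt_mk) // (_ : nth _ _ _ = Ordinal lt_mk) -?nexp_chainS //.
by apply: val_inj; rewrite /= nth_enum_ord.
Qed.

Lemma chain_coef_posetted t :
  chain_coef k t = if posetted t then tree_coef t else 0.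
Proof. by rewrite /chain_coef ltn_ord andbT posettedE tree_coefE. Qed.
End Chain.

(** * Lie algebras and the Dynkin map *)

Section Ratr.
Variables (K : fieldType) (charK : [pchar K] =i pred0).

Lemma intr_eq0_pchar (m : int) : (m%:~R == 0 :> K) = (m == 0).
Proof.
by case: m => n; rewrite ?NegzE ?mulrNz ?oppr_eq0 -pmulrn ((pcharf0P K).1 charK).
Qed.

(** Allows fractions that are not reduced, so that the ring laws of [ratr] can be checked on a
    common denominator; characteristic 0 keeps denominators invertible in K. *)
Lemma ratr_frac (x : rat) (m d : int) : d != 0 ->
  x * d%:~R = m%:~R -> ratr x = m%:~R / d%:~R :> K.
Proof.
move=> d0 xd; apply: (canRL (mulfK _)); rewrite ?intr_eq0_pchar //.
rewrite /ratr mulrAC; apply: (canLR (mulfK _)); first by rewrite intr_eq0_pchar denq_eq0.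
rewrite -!intrM; congr _%:~R; apply: (@intr_inj rat).
by rewrite !intrM numqE -xd mulrAC.
Qed.

Lemma ratrD_pchar (x y : rat) : ratr (x + y) = ratr x + ratr y :> K.
Proof.
rewrite (@ratr_frac (x + y) (numq x * denq y + numq y * denq x) (denq x * denq y)).
- rewrite /ratr intrD !intrM addf_div ?intr_eq0_pchar ?denq_eq0 //.
- by rewrite mulf_neq0 ?denq_eq0.
by rewrite intrD !intrM !numqE; ring.
Qed.

Lemma ratrM_pchar (x y : rat) : ratr (x * y) = ratr x * ratr y :> K.
Proof.
rewrite (@ratr_frac (x * y) (numq x * numq y) (denq x * denq y)).
- by rewrite /ratr !intrM mulf_div.
- by rewrite mulf_neq0 ?denq_eq0.
by rewrite !intrM !numqE mulrACA.
Qed.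

Lemma ratr0_pchar : ratr 0 = 0 :> K.
Proof. by rewrite (ratr_int K 0). Qed.

Lemma ratr1_pchar : ratr 1 = 1 :> K.
Proof. by rewrite (ratr_int K 1). Qed.

Lemma ratrN_pchar (x : rat) : ratr (- x) = - ratr x :> K.
Proof. by apply: (addrI (ratr x)); rewrite -ratrD_pchar !subrr ratr0_pchar. Qed.
End Ratr.

(** * The lower descending series as a filtration *)

Section LieBasics.
Variables (K : fieldType) (L : lieAlgType K).
Implicit Types (x y z : L) (a : K).

Lemma lieDl x y z : lie (x + y) z = lie x z + lie y z.
Proof. by have := lie_linear_left z 1 x y; rewrite !scale1r. Qed.

Lemma lieDr x y z : lie x (y + z) = lie x y + lie x z.
Proof. by have := lie_linear_right x 1 y z; rewrite !scale1r. Qed.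

Lemma lie0r x : lie x 0 = 0.
Proof. by apply: (addrI (lie x 0)); rewrite -lieDr !addr0. Qed.

Lemma lie0l x : lie 0 x = 0.
Proof. by apply: (addrI (lie 0 x)); rewrite -lieDl !addr0. Qed.

Lemma lieZr a x y : lie x (a *: y) = a *: lie x y.
Proof. by have := lie_linear_right x a y 0; rewrite !addr0 lie0r addr0. Qed.

Lemma lieZl a x y : lie (a *: x) y = a *: lie x y.
Proof. by have := lie_linear_left y a x 0; rewrite !addr0 lie0l addr0. Qed.

Lemma lieNr x y : lie x (- y) = - lie x y.
Proof. by rewrite -scaleN1r lieZr scaleN1r. Qed.

Lemma lieNl x y : lie (- x) y = - lie x y.
Proof. by rewrite -scaleN1r lieZl scaleN1r. Qed.

Lemma lieC x y : lie x y = - lie y x.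
Proof.
apply/eqP; rewrite -addr_eq0; apply/eqP.
by have := lie_alternating (x + y); rewrite lieDl !lieDr !lie_alternating add0r addr0.
Qed.

Lemma lie_sumr x (I : Type) (r : seq I) (P : pred I) (F : I -> L) :
  lie x (\sum_(i <- r | P i) F i) = \sum_(i <- r | P i) lie x (F i).
Proof. exact: (big_morph _ (lieDr x) (lie0r x)). Qed.

Lemma lie_suml x (I : Type) (r : seq I) (P : pred I) (F : I -> L) :
  lie (\sum_(i <- r | P i) F i) x = \sum_(i <- r | P i) lie (F i) x.
Proof. exact: (big_morph (lie^~ x) (fun y z => lieDl y z x) (lie0l x)). Qed.

Lemma lie_lie x y z : lie (lie x y) z = lie x (lie y z) - lie y (lie x z).
Proof.
have := lie_jacobi x y z; rewrite [lie z x]lieC lieNr [lie z _]lieC => /eqP.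
by rewrite subr_eq0 => /eqP.
Qed.

Lemma lcs0 n : lcs n (0 : L).
Proof.
case: n => [|[|n]] //=; exists 0%N, (fun _ => 0), (fun _ => 0); split; first by case.
by rewrite big_ord0.
Qed.

Lemma lcsD n x y : lcs n x -> lcs n y -> lcs n (x + y).
Proof.
case: n => [|[|n]] //= -[m1 [c1 [v1 [A1 ->]]]] [m2 [c2 [v2 [A2 ->]]]].
exists (m1 + m2)%N,
  (fun i : 'I_(m1 + m2) => match fintype.split i with inl j => c1 j | inr j => c2 j end),
  (fun i : 'I_(m1 + m2) => match fintype.split i with inl j => v1 j | inr j => v2 j end).
split; first by move=> i; case: fintype.split.
rewrite big_split_ord /=; congr (_ + _); apply: eq_bigr => i _.
  by rewrite (unsplitK (inl i)).
by rewrite (unsplitK (inr i)).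
Qed.

Lemma lcsZ n a x : lcs n x -> lcs n (a *: x).
Proof.
case: n => [|[|n]] //= -[m [c [v [A ->]]]]; exists m, (fun i => a * c i), v.
by split=> //; rewrite scaler_sumr; apply: eq_bigr => i _; rewrite scalerA.
Qed.

Lemma lcsN n x : lcs n x -> lcs n (- x).
Proof. by rewrite -scaleN1r; apply: lcsZ. Qed.

Lemma lcsB n x y : lcs n x -> lcs n y -> lcs n (x - y).
Proof. by move=> ? ?; apply: lcsD => //; apply: lcsN. Qed.

Lemma lcs_sum n (I : Type) (r : seq I) (P : pred I) (F : I -> L) :
  (forall i, P i -> lcs n (F i)) -> lcs n (\sum_(i <- r | P i) F i).
Proof. by move=> FP; apply: big_ind => //; [apply: lcs0 | apply: lcsD]. Qed.

Lemma lcs_lieS n x y : lcs n x -> lcs n.+1 (lie x y).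
Proof.
case: n => [|n] // xn; exists 1%N, (fun _ => 1), (fun _ => lie x y).
by split=> [_|]; [exists x, y | rewrite big_ord_recl big_ord0 addr0 scale1r].
Qed.

Lemma lcsW n x : lcs n.+1 x -> lcs n x.
Proof.
elim: n x => [|[|n] IH] // x [m [c [v [A ->]]]].
apply: lcs_sum => i _; apply: lcsZ; have [y [z [/IH yn ->]]] := A i.
exact: lcs_lieS.
Qed.

Lemma lcs_leq m n x : (m <= n)%N -> lcs n x -> lcs m x.
Proof. by move=> /subnK <-; elim: (n - m)%N => // k IH /lcsW. Qed.

Lemma lcs_lie i j x y : lcs i x -> lcs j y -> lcs (i + j) (lie x y).
Proof.
elim: j i x y => [|[|j] IH] i x y xi.
- by move=> _; rewrite addn0; apply/lcsW/lcs_lieS.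
- by move=> _; rewrite addn1; apply: lcs_lieS.
case=> m [c [v [A ->]]]; rewrite lie_sumr; apply: lcs_sum => l _.
rewrite lieZr; apply: lcsZ; have [y1 [y2 [y1j ->]]] := A l.
(* Jacobi moves the outer factor of a generator [y1, y2] to the left argument, leaving brackets with
   y1 in L^(j+1), to which the induction applies. *)
have -> : lie x (lie y1 y2) = lie (lie x y1) y2 - lie (lie x y2) y1.
  by rewrite lie_lie [lie (lie x y2) y1]lieC opprK subrK.
rewrite addnS; apply: lcsB; first by apply/lcs_lieS/IH.
by rewrite -addSn; apply: IH => //; apply: lcs_lieS.
Qed.

Lemma lcs_lier n x y : lcs n y -> lcs n (lie x y).
Proof. by move=> yn; rewrite lieC; apply/lcsN/lcsW/lcs_lieS. Qed.

Lemma lcs_liel n x y : lcs n x -> lcs n (lie x y).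
Proof. by move=> xn; apply/lcsW/lcs_lieS. Qed.

Lemma lcs_lieB n x x' y y' : lcs n (x - x') -> lcs n (y - y') ->
  lcs n (lie x y - lie x' y').
Proof.
move=> xx yy; have -> : lie x y - lie x' y' = lie (x - x') y + lie x' (y - y').
  by rewrite lieDl lieDr lieNl lieNr addrA subrK.
by apply: lcsD; [apply: lcs_liel | apply: lcs_lier].
Qed.

Lemma lcs_trans n x y z : lcs n (x - y) -> lcs n (y - z) -> lcs n (x - z).
Proof. by move=> xy yz; rewrite -(subrK y x) -addrA; apply: lcsD. Qed.

Lemma lcs_subC n x y : lcs n (x - y) -> lcs n (y - x).
Proof. by rewrite -opprB; move=> /lcsN; rewrite opprK. Qed.
End LieBasics.

Section Dynkin.
Variables (K : fieldType) (charK : [pchar K] =i pred0).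
Variables (L : lieAlgType K) (T : finType) (ev : T -> L).
Implicit Types (f g : ncs T) (p q : lie_poly T) (x y : L).

Let ratrD := ratrD_pchar charK.
Let ratrM := ratrM_pchar charK.

Definition lie_poly_ncs p : ncs T := lie_poly_nc p.

(* The word c_1 ... c_m acts on L as ad c_1 ... ad c_m; [word_act m f] is the
   action of the component of degree m of f. *)
Fixpoint word_act m f y : L :=
  if m is m'.+1 then \sum_c lie (ev c) (word_act m' (ncder c f) y)
  else ratr (f [::]) *: y.

(* The component of degree m of f under c_1 ... c_m |-> [c_1, [..., c_m]]. *)
Fixpoint dynkin m f : L :=
  match m with
  | 0 => 0
  | 1 => \sum_c (ratr (f [:: c]) *: ev c)
  | m'.+1 => \sum_c lie (ev c) (dynkin m' (ncder c f))
  end.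

Arguments dynkin : simpl never.

Lemma dynkin_0E f : dynkin 0 f = 0. Proof. by []. Qed.

Lemma dynkin_1E f : dynkin 1 f = \sum_c ratr (f [:: c]) *: ev c.
Proof. by []. Qed.

Lemma dynkinSS m f :
  dynkin m.+2 f = \sum_c lie (ev c) (dynkin m.+1 (ncder c f)).
Proof. by []. Qed.

Lemma ncderD c f g : ncder c (f + g) = (ncder c f : ncs T) + ncder c g.
Proof. by []. Qed.

Lemma ncderZ c a f : ncder c (a *: f) = a *: (ncder c f : ncs T).
Proof. by []. Qed.

Lemma word_actD m f g y : word_act m (f + g) y = word_act m f y + word_act m g y.
Proof.
elim: m f g => [|m IH] f g /=; first by rewrite ncs_addE ratrD scalerDl.
by rewrite -big_split; apply: eq_bigr => c _; rewrite ncderD IH lieDr.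
Qed.

Lemma word_actZ m a f y : word_act m (a *: f) y = ratr a *: word_act m f y.
Proof.
elim: m f => [|m IH] f /=; first by rewrite ncs_scaleE ratrM scalerA.
by rewrite scaler_sumr; apply: eq_bigr => c _; rewrite ncderZ IH lieZr.
Qed.

Lemma dynkinD m f g : dynkin m (f + g) = dynkin m f + dynkin m g.
Proof.
elim: m f g => [|[|m] IH] f g; first by rewrite addr0.
  rewrite !dynkin_1E -big_split; apply: eq_bigr => c _.
  by rewrite ncs_addE ratrD scalerDl.
rewrite !dynkinSS -big_split; apply: eq_bigr => c _.
by rewrite ncderD IH lieDr.
Qed.

Lemma dynkinZ m a f : dynkin m (a *: f) = ratr a *: dynkin m f.
Proof.
elim: m f => [|[|m] IH] f; first by rewrite scaler0.
  rewrite !dynkin_1E scaler_sumr; apply: eq_bigr => c _.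
  by rewrite ncs_scaleE ratrM scalerA.
rewrite !dynkinSS scaler_sumr; apply: eq_bigr => c _.
by rewrite ncderZ IH lieZr.
Qed.

Lemma word_actB m f g y : word_act m (f - g) y = word_act m f y - word_act m g y.
Proof.
by rewrite -scaleN1r word_actD word_actZ (ratrN_pchar charK) ratr1_pchar scaleN1r.
Qed.

Lemma dynkinB m f g : dynkin m (f - g) = dynkin m f - dynkin m g.
Proof.
by rewrite -scaleN1r dynkinD dynkinZ (ratrN_pchar charK) ratr1_pchar scaleN1r.
Qed.

Lemma ncderM c f g :
  ncder c (f * g) = (f [::] : rat) *: (ncder c g : ncs T) + (ncder c f : ncs T) * g.
Proof. exact: ncder_mul. Qed.

Lemma word_actM m f g y :
  word_act m (f * g) y = \sum_(i < m.+1) word_act i f (word_act (m - i) g y).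
Proof.
elim: m f g => [|m IH] f g.
  by rewrite big_ord_recl big_ord0 addr0 /= ncs_mul_nil ratrM scalerA.
rewrite big_ord_recl /= scaler_sumr exchange_big -big_split /=.
apply: eq_bigr => c _; rewrite ncderM word_actD word_actZ lieDr lieZr; congr (_ + _).
by rewrite IH lie_sumr; apply: eq_bigr => i _; rewrite subSS.
Qed.

(** On a word u v with v non empty, the right-nested bracket is ad u applied to the bracket of v.
    The last term accounts for v empty. *)
Lemma dynkinM m f g :
  dynkin m (f * g) =
  \sum_(i < m.+1) word_act i f (dynkin (m - i) g) + ratr (g [::]) *: dynkin m f.
Proof.
elim: m f g => [|[|m] IH] f g.
- by rewrite big_ord_recl big_ord0 addr0 /= !dynkin_0E !scaler0 addr0.
- rewrite !big_ord_recl big_ord0 addr0 /= !dynkin_1E [X in _ + X + _]big1 ?addr0; last first.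
    by move=> c _; rewrite subnn dynkin_0E scaler0 lie0r.
  rewrite !scaler_sumr -big_split; apply: eq_bigr => c _ /=.
  rewrite ncs_mul_cons ncs_mul_nil ratrD !ratrM scalerDl !scalerA.
  by rewrite [ratr (g [::]) * _]mulrC.
rewrite dynkinSS big_ord_recl /= scaler_sumr exchange_big !scaler_sumr -!big_split /=.
apply: eq_bigr => c _; rewrite ncderM dynkinD dynkinZ lieDr lieZr -addrA; congr (_ + _).
rewrite IH lieDr lieZr; congr (_ + _).
by rewrite lie_sumr; apply: eq_bigr => i _; rewrite subSS.
Qed.

Lemma ncder1 c : ncder c (1 : ncs T) = 0.
Proof. by []. Qed.

Lemma ncder_X (c a : T) : ncder c (nX a) = (c == a)%:R *: (1 : ncs T).
Proof.
by apply/funext => w; rewrite ncs_scaleE /nX /ncder /ncX eqseq_cons -natrM mulnb.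
Qed.

Lemma word_act0 m y : word_act m 0 y = 0.
Proof. by rewrite -(scale0r 0) word_actZ ratr0_pchar scale0r. Qed.

Lemma dynkin0 m : dynkin m 0 = 0.
Proof. by rewrite -(scale0r 0) dynkinZ ratr0_pchar scale0r. Qed.

Lemma word_act1 m y : word_act m 1 y = if m == 0%N then y else 0.
Proof.
case: m => [|m] /=; first by rewrite ratr1_pchar scale1r.
by apply: big1 => c _; rewrite ncder1 word_act0 lie0r.
Qed.

Lemma dynkin1 m : dynkin m 1 = 0.
Proof.
case: m => [|[|m]] //; last first.
  by rewrite dynkinSS big1 // => c _; rewrite ncder1 dynkin0 lie0r.
by rewrite dynkin_1E big1 // => c _; rewrite ratr0_pchar scale0r.
Qed.

(* The component of degree m of the evaluation of p. *)
Fixpoint lie_poly_heval p m : L :=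
  match p with
  | LieVar x => if m == 1%N then ev x else 0
  | LieZero => 0
  | LieAdd p q => lie_poly_heval p m + lie_poly_heval q m
  | LieScale c p => ratr c *: lie_poly_heval p m
  | LieBracket p q =>
      \sum_(i < m.+1) lie (lie_poly_heval p i) (lie_poly_heval q (m - i)%N)
  end.

Lemma lie_poly_ncs_bracket p q :
  lie_poly_ncs (LieBracket p q) = adr (lie_poly_ncs p) (lie_poly_ncs q).
Proof. by []. Qed.

Lemma lie_poly_ncs_nil p : lie_poly_ncs p [::] = 0.
Proof.
elim: p => //= [p IHp q IHq|c p IHp|p IHp q IHq].
- by rewrite /lie_poly_ncs /= -[X in X + _]/(lie_poly_ncs p [::]) IHp add0r.
- by rewrite /lie_poly_ncs /= -[X in _ * X]/(lie_poly_ncs p [::]) IHp mulr0.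
by rewrite lie_poly_ncs_bracket /adr ncs_subE !ncs_mul_nil IHp IHq mulr0 subrr.
Qed.

Lemma sum_var (a : T) (F : T -> L) : \sum_c ratr (c == a)%:R *: F c = F a.
Proof.
rewrite (bigD1 a) //= eqxx ratr1_pchar scale1r big1 ?addr0 // => c /negPf ->.
by rewrite ratr0_pchar scale0r.
Qed.

(** Jacobi says that ad turns brackets into commutators, so a Lie polynomial acts as ad of its
    value, degree by degree. *)
Lemma word_act_lie m p y :
  word_act m (lie_poly_ncs p) y = lie (lie_poly_heval p m) y.
Proof.
elim: p m y => [x||p IHp q IHq|c p IHp|p IHp q IHq] m y /=.
- case: m => [|m] /=; first by rewrite ratr0_pchar scale0r lie0l.
  under eq_bigr => c _ do rewrite ncder_X word_actZ lieZr.
  by rewrite sum_var word_act1; case: m => //=; rewrite lie0r lie0l.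
- by rewrite (word_act0 m y) lie0l.
- by rewrite (word_actD m (lie_poly_ncs p) (lie_poly_ncs q)) IHp IHq lieDl.
- by rewrite (word_actZ m c (lie_poly_ncs p)) IHp lieZl.
rewrite lie_poly_ncs_bracket /adr word_actB !word_actM.
rewrite [X in _ - X](reindex_inj rev_ord_inj) -sumrB lie_suml /=.
apply: eq_bigr => i _; rewrite subSS subKn -1?ltnS // lie_lie.
by rewrite !IHp !IHq.
Qed.

(** On a bracket, with p in degree i and q in degree m - i, the product rule gives p.D(q) - q.D(p) =
    (m - i) [p, q] + i [p, q]. *)
Lemma dynkin_lie m p :
  dynkin m (lie_poly_ncs p) = m%:R *: lie_poly_heval p m.
Proof.
elim: p m => [x||p IHp q IHq|c p IHp|p IHp q IHq] m /=.
- case: m => [|[|m]]; first by rewrite scaler0.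
    rewrite scale1r dynkin_1E -[RHS](sum_var x ev) /=; apply: eq_bigr => c _.
    by rewrite /lie_poly_ncs /= /ncX eqseq_cons andbT.
  rewrite dynkinSS /= scaler0 big1 // => c _.
  by rewrite ncder_X dynkinZ dynkin1 scaler0 lie0r.
- by rewrite (dynkin0 m) scaler0.
- by rewrite (dynkinD m (lie_poly_ncs p) (lie_poly_ncs q)) IHp IHq scalerDr.
- by rewrite (dynkinZ m c (lie_poly_ncs p)) IHp !scalerA mulrC.
rewrite lie_poly_ncs_bracket /adr dynkinB !dynkinM !lie_poly_ncs_nil.
rewrite ratr0_pchar !scale0r !addr0 [X in _ - X](reindex_inj rev_ord_inj) -sumrB.
rewrite scaler_sumr /=; apply: eq_bigr => i _; have le_im : (i <= m)%N by rewrite -ltnS.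
rewrite subSS subKn // !word_act_lie IHp IHq !lieZr.
rewrite [lie (lie_poly_heval q _) _]lieC scalerN opprK -scalerDl -natrD.
by rewrite subnK.
Qed.

Lemma dynkin_eqm M m f g : eqm M f g -> (m < M)%N -> dynkin m f = dynkin m g.
Proof.
elim: m M f g => [|[|m] IH] M f g fg ltM //.
  by apply: eq_bigr => c _; rewrite fg.
rewrite !dynkinSS; apply: eq_bigr => c _; congr lie.
by case: M ltM fg => // M ltM fg; apply: (IH M) => // w lt_wM; apply: fg.
Qed.

Lemma lie_poly_heval_lcs p m : lcs m (lie_poly_heval p m).
Proof.
elim: p m => [x||p IHp q IHq|c p IHp|p IHp q IHq] m /=.
- by case: eqP => [-> //|_]; apply: lcs0.
- exact: lcs0.
- exact: lcsD.
- exact: lcsZ.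
apply: lcs_sum => i _; have le_im : (i <= m)%N by rewrite -ltnS.
by rewrite -[m in lcs m](subnKC le_im); apply: lcs_lie.
Qed.

Lemma lie_poly_heval_sum p M :
  lcs M (lie_poly_eval ev p - \sum_(m < M) lie_poly_heval p m).
Proof.
elim: p => [x||p IHp q IHq|c p IHp|p IHp q IHq] /=.
- case: M => [|[|M]] //; rewrite !big_ord_recl /= add0r big1 // addr0 subrr.
  exact: (lcs0 L M.+2).
- by rewrite big1 // subrr; apply: lcs0.
- by rewrite big_split opprD addrACA; apply: lcsD.
- by rewrite -scaler_sumr -scalerBr; apply: lcsZ.
apply: lcs_trans (lcs_lieB IHp IHq) _.
pose F (i j : nat) := lie (lie_poly_heval p i) (lie_poly_heval q j).
(* The bracket of the two truncations fills a square of degrees, the homogeneous components only the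
   triangle i + j < M; the remaining terms lie in L^M. *)
pose G i j := if (i + j < M)%N then F i j else 0.
have -> : \sum_(m < M) \sum_(i < m.+1) lie (lie_poly_heval p i) (lie_poly_heval q (m - i)%N)
        = \sum_(i < M) \sum_(j < M) G i j.
  rewrite sum_triangle => [|i j]; last by rewrite /G leqNgt => /negPf->.
  apply: eq_bigr => n _; apply: eq_bigr => i _; rewrite /G subnKC ?ltn_ord //.
  by rewrite -ltnS.
rewrite lie_suml -sumrB; apply: lcs_sum => i _.
rewrite lie_sumr -sumrB; apply: lcs_sum => j _.
rewrite /G; case: ltnP => [_|leM]; first by rewrite subrr; apply: lcs0.
by rewrite subr0; apply: lcs_leq leM _; apply: lcs_lie; apply: lie_poly_heval_lcs.
Qed.

Lemma lie_poly_heval0 p : lie_poly_heval p 0 = 0.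
Proof.
elim: p => //= [p -> q ->|c p ->|p IHp q IHq]; rewrite ?addr0 ?scaler0 //.
by rewrite big_ord_recl big_ord0 addr0 IHp lie0l.
Qed.

(* Dynkin-Specht-Wever; no embedding of the free Lie algebra is needed. *)
Lemma lie_poly_eval_eqm M p q : eqm M (lie_poly_ncs p) (lie_poly_ncs q) ->
  lcs M (lie_poly_eval ev p - lie_poly_eval ev q).
Proof.
move=> pq; apply: lcs_trans (lie_poly_heval_sum p M) _; apply: lcs_subC.
rewrite (eq_bigr (fun m : 'I_M => lie_poly_heval q m)) => [|[[|m] ltM] _ /=].
- exact: lie_poly_heval_sum.
- by rewrite !lie_poly_heval0.
(* Characteristic 0 lets the degree be divided out; degree 0 is treated apart, its component being
   zero. *)
have m0 : m.+1%:R != 0 :> K by rewrite ((pcharf0P K).1 charK).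
by apply: (scalerI m0); rewrite -!dynkin_lie; apply: dynkin_eqm pq ltM.
Qed.
End Dynkin.

(** * Substitution and Lie series *)

Fixpoint lie_subst (T T' : Type) (s : T -> lie_poly T') (p : lie_poly T) :
    lie_poly T' :=
  match p with
  | LieVar x => s x
  | LieZero => LieZero T'
  | LieAdd p q => LieAdd (lie_subst s p) (lie_subst s q)
  | LieScale c p => LieScale c (lie_subst s p)
  | LieBracket p q => LieBracket (lie_subst s p) (lie_subst s q)
  end.

Section Substitution.
Variables (T : finType) (T' : eqType).
Implicit Types (f g : ncs T) (phi psi : T -> ncs T').

(* Truncation of the substitution of phi in f, via f = f(1) + sum_c c (d_c f). *)
Fixpoint nc_subst m phi f : ncs T' :=
  if m is m'.+1 then (f [::] : rat) *: 1 + \sum_c phi c * nc_subst m' phi (ncder c f)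
  else 0.

Lemma nc_substD m phi f g : nc_subst m phi (f + g) = nc_subst m phi f + nc_subst m phi g.
Proof.
elim: m f g => [|m IH] f g /=; first by rewrite addr0.
rewrite ncs_addE scalerDl addrACA -big_split; congr (_ + _).
by apply: eq_bigr => c _; rewrite ncderD IH mulrDr.
Qed.

Lemma nc_substZ m phi a f : nc_subst m phi (a *: f) = a *: nc_subst m phi f.
Proof.
elim: m f => [|m IH] f /=; first by rewrite scaler0.
rewrite ncs_scaleE scalerDr scalerA scaler_sumr; congr (_ + _).
by apply: eq_bigr => c _; rewrite ncderZ IH scalerAr.
Qed.

Lemma nc_subst0 m phi : nc_subst m phi 0 = 0.
Proof. by rewrite -(scale0r 0) nc_substZ scale0r. Qed.

Lemma nc_substB m phi f g : nc_subst m phi (f - g) = nc_subst m phi f - nc_subst m phi g.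
Proof. by rewrite -scaleN1r nc_substD nc_substZ scaleN1r. Qed.

Lemma nc_subst_sum m phi (I : Type) (r : seq I) (P : pred I) (F : I -> ncs T) :
  nc_subst m phi (\sum_(i <- r | P i) F i) = \sum_(i <- r | P i) nc_subst m phi (F i).
Proof. exact: (big_morph _ (nc_substD m phi) (nc_subst0 m phi)). Qed.

Lemma nc_subst_eqm m phi f g : eqm m f g -> nc_subst m phi f = nc_subst m phi g.
Proof.
elim: m f g => //= m IH f g fg; rewrite fg //; congr (_ + _).
by apply: eq_bigr => c _; rewrite (IH _ (ncder c g)) // => w ltw; apply: fg.
Qed.

Variable phi : T -> ncs T'.
Hypothesis phi0 : forall c, eqm 1 (phi c) 0.

Lemma nc_substS m f : eqm m (nc_subst m phi f) (nc_subst m.+1 phi f).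
Proof.
elim: m f => // m IH f; apply: eqmD => //; apply: eqm_sum => c _.
by apply: eqmMS.
Qed.

Lemma nc_subst_leq m n f : (m <= n)%N -> eqm m (nc_subst m phi f) (nc_subst n phi f).
Proof.
move=> /subnK <-; elim: (n - m)%N => // k IH; apply: eqm_trans IH _.
by apply: (eqm_leq _ (@nc_substS _ _)); rewrite leq_addl.
Qed.

(** Only the limit is an algebra morphism; the truncation is one up to order m. The factor [phi c],
    without constant term, supplies the degree gained at each step. *)
Lemma nc_substM m f g :
  eqm m (nc_subst m phi (f * g)) (nc_subst m phi f * nc_subst m phi g).
Proof.
elim: m f g => // m IH f g; set Sg := nc_subst m.+1 phi g.
have -> : nc_subst m.+1 phi (f * g) =
    (f [::] : rat) *: Sg + \sum_c phi c * nc_subst m phi ((ncder c f : ncs T) * g).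
  rewrite /Sg /= ncs_mul_nil scalerDr scalerA -addrA scaler_sumr -big_split.
  congr (_ + _); apply: eq_bigr => c _ /=.
  by rewrite ncderM nc_substD nc_substZ mulrDr -scalerAr.
rewrite [nc_subst m.+1 phi f]/= mulrDl mulr_algl mulr_suml; apply: eqmD => //.
apply: eqm_sum => c _; rewrite -mulrA; apply: eqmMS => //.
by apply: eqm_trans (IH _ _) _; apply: eqmM => //; apply: nc_substS.
Qed.

Lemma nc_subst1 m : eqm m (nc_subst m phi 1) 1.
Proof.
case: m => // m; rewrite /= scale1r big1 ?addr0 // => c _.
by rewrite ncder1 nc_subst0 mulr0.
Qed.

Lemma nc_substX m f n : eqm m (nc_subst m phi (f ^+ n)) (nc_subst m phi f ^+ n).
Proof.
elim: n => [|n IH]; first exact: nc_subst1.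
rewrite !exprS; apply: eqm_trans (nc_substM _ _) _.
exact: eqmM.
Qed.

Lemma nc_subst_var m c : eqm m (nc_subst m phi (nX c)) (phi c).
Proof.
case: m => // m; rewrite /= {1}/nX {1}/ncX scale0r add0r (bigD1 c) //= big1 ?addr0.
  rewrite ncder_X eqxx scale1r -[X in eqm _ _ X]mulr1; apply: eqmMS => //.
  exact: nc_subst1.
by move=> b /negPf neq_bc; rewrite ncder_X neq_bc scale0r nc_subst0 mulr0.
Qed.

Lemma nc_subst_nil m f : f [::] = 0 -> nc_subst m phi f [::] = 0.
Proof.
case: m => // m f0; rewrite /= f0 scale0r add0r ncs_sumE big1 // => c _.
by rewrite ncs_mul_nil phi0 ?mul0r.
Qed.

Lemma nc_subst_exp m f : f [::] = 0 ->
  eqm m (nc_subst m phi (nexp f)) (nexp (nc_subst m phi f)).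
Proof.
move=> f0; rewrite (nc_subst_eqm _ (nexp_eqm f0)).
apply: eqm_trans (eqm_sym (nexp_eqm (nc_subst_nil m f0))).
rewrite nc_subst_sum; apply: eqm_sum => n _; rewrite nc_substZ.
by apply: eqmZ; apply: nc_substX.
Qed.
End Substitution.

Lemma eqm_nexp (T : eqType) m (f g : ncs T) : f [::] = 0 -> g [::] = 0 ->
  eqm m f g -> eqm m (nexp f) (nexp g).
Proof.
move=> f0 g0 fg; apply: eqm_trans (nexp_eqm f0) _.
apply: eqm_trans (eqm_sym (nexp_eqm g0)).
by apply: eqm_sum => n _; apply: eqmZ; apply: eqmX.
Qed.

Lemma nc_subst_cong (T : finType) (T' : eqType) m n (phi psi : T -> ncs T') f :
  (forall c, eqm m (phi c) (psi c)) -> eqm m (nc_subst n phi f) (nc_subst n psi f).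
Proof.
move=> E; elim: n f => //= n IH f; apply: eqmD => //.
by apply: eqm_sum => c _; apply: eqmM.
Qed.

Lemma lie_subst_nc (T T' : finType) m (s : T -> lie_poly T') (p : lie_poly T) :
  eqm m (lie_poly_ncs (lie_subst s p))
        (nc_subst m (fun c => lie_poly_ncs (s c)) (lie_poly_ncs p)).
Proof.
have s0 c : eqm 1 (lie_poly_ncs (s c)) 0 by apply/eqm1/lie_poly_ncs_nil.
elim: p => [x||p IHp q IHq|c p IHp|p IHp q IHq].
- exact/eqm_sym/nc_subst_var.
- by rewrite [lie_poly_ncs (LieZero _)](_ : _ = 0) // nc_subst0.
- rewrite [lie_poly_ncs (LieAdd p q)](_ : _ = lie_poly_ncs p + lie_poly_ncs q) //.
  by rewrite nc_substD; apply: eqmD.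
- rewrite [lie_poly_ncs (LieScale c p)](_ : _ = c *: lie_poly_ncs p) //.
  by rewrite nc_substZ; apply: eqmZ.
rewrite !lie_poly_ncs_bracket /= /adr nc_substB; apply: eqmB.
  by apply: eqm_trans (eqm_sym (nc_substM _ _ _)) => //; apply: eqmM.
by apply: eqm_trans (eqm_sym (nc_substM _ _ _)) => //; apply: eqmM.
Qed.

Section Represent.
Variables (K : fieldType) (charK : [pchar K] =i pred0).
Variables (L : lieAlgType K).

Lemma lie_subst_eval (T T' : finType) (ev : T' -> L) (s : T -> lie_poly T') p :
  lie_poly_eval ev (lie_subst s p) = lie_poly_eval (fun c => lie_poly_eval ev (s c)) p.
Proof. by elim: p => //= [p -> q ->|c p ->|p -> q ->]. Qed.

Lemma lie_poly_eval_lcs (T : Type) n (u v : T -> L) p :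
  (forall c, lcs n (u c - v c)) -> lcs n (lie_poly_eval u p - lie_poly_eval v p).
Proof.
move=> uv; elim: p => [x||p IHp q IHq|c p IHp|p IHp q IHq] //=.
- by rewrite subrr; apply: lcs0.
- by rewrite opprD addrACA; apply: lcsD.
- by rewrite -scalerBr; apply: lcsZ.
exact: lcs_lieB.
Qed.

(* f is a Lie series, with value c at ev. *)
Definition represents (T : finType) (ev : T -> L) (f : ncs T) (c : L) : Prop :=
  forall n, exists p, eqm n (lie_poly_ncs p) f /\ lcs n (lie_poly_eval ev p - c).

Definition homogeneous_components (T : finType) (P : nat -> lie_poly T) (f : ncs T) :=
  forall n w, lie_poly_ncs (P n) w = if size w == n then f w else 0.

Lemma represents_nil (T : finType) (ev : T -> L) f c : represents ev f c -> f [::] = 0.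
Proof. by move=> /(_ 1%N)[p [E _]]; rewrite -E // lie_poly_ncs_nil. Qed.

Lemma represents_var (T : finType) (ev : T -> L) x : represents ev (nX x) (ev x).
Proof. by move=> n; exists (LieVar x); rewrite /= subrr; split; last exact: lcs0. Qed.

Section Components.
Variables (T : finType) (ev : T -> L) (P : nat -> lie_poly T) (f : ncs T).
Hypothesis Pf : homogeneous_components P f.

Definition partial_sum N : lie_poly T :=
  foldr (fun n p => LieAdd (P n) p) (LieZero T) (index_iota 1 N.+1).

Lemma partial_sum_eval N :
  lie_poly_eval ev (partial_sum N) = \sum_(1 <= n < N.+1) lie_poly_eval ev (P n).
Proof.
by rewrite /partial_sum; elim: index_iota => [|n s IH] /=; rewrite ?big_nil // big_cons IH.
Qed.

Lemma partial_sum_nc N : eqm N.+1 (lie_poly_ncs (partial_sum N)) f.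
Proof.
move=> w ltw; have -> : lie_poly_ncs (partial_sum N) w =
    \sum_(1 <= n < N.+1) lie_poly_ncs (P n) w.
  rewrite /partial_sum; elim: index_iota => [|n s IH] /=; first by rewrite big_nil.
  by rewrite big_cons -IH.
under eq_bigr => n _ do rewrite Pf.
(* The sum starts at degree 1, which is enough since a Lie polynomial has no constant term and so f
   vanishes on the empty word. *)
case: w ltw => [|c w] ltw.
  rewrite big_nat big1 => [|n /andP[n0 _]]; last by rewrite eq_sym gtn_eqF.
  by have := Pf 0 [::]; rewrite lie_poly_ncs_nil.
rewrite -big_mkcond /=; under eq_bigl => n do rewrite eq_sym.
by rewrite big_nat1_eq ltw.
Qed.

(** Lie polynomials agreeing to order n have values congruent modulo L^n, so the partial sums may be
    compared with any approximation. This makes the choice of P in [is_bch] immaterial. *)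
Lemma represents_series c :
  represents ev f c <-> lie_series (fun n => lie_poly_eval ev (P n)) c.
Proof.
split=> [rep n|ser n].
  have [p [pf pc]] := rep n; exists n => N le_nN; rewrite -partial_sum_eval.
  apply: lcs_trans pc; apply: (lie_poly_eval_eqm charK).
  apply: eqm_trans (eqm_sym pf); apply: (eqm_leq _ (@partial_sum_nc N)).
  exact: leqW.
have [N0 /(_ (maxn N0 n) (leq_maxl _ _))] := ser n; rewrite -partial_sum_eval => ?.
exists (partial_sum (maxn N0 n)); split=> //; apply: (eqm_leq _ (@partial_sum_nc _)).
by rewrite leqW ?leq_maxr.
Qed.

Lemma component_lcs n : lcs n (lie_poly_eval ev (P n)).
Proof.
rewrite -[lie_poly_eval _ _]subr0; apply: (@lie_poly_eval_eqm _ charK _ _ _ _ _ (LieZero T)).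
by move=> w ltw; rewrite Pf ltn_eqF.
Qed.

Hypothesis completeL : lie_complete L.

(** The component of degree n lies in L^n, so the classes of the partial sums form a point of the
    inverse limit, and completeness lifts it to L. *)
Lemma series_converges : exists c, lie_series (fun n => lie_poly_eval ev (P n)) c.
Proof.
pose s N := \sum_(1 <= n < N.+1) lie_poly_eval ev (P n).
have sS N : s N.+1 - s N = lie_poly_eval ev (P N.+1).
  by rewrite /s [X in X - _]big_nat_recr //= addrAC subrr add0r.
have [_ _ surj] := completeL.
have invlim_s : lcs_invlim (fun n => lcs_coset n (s n)).
  split=> [n|n x]; first by exists (s n).
  move=> xs; rewrite /lcs_coset /=; apply: (@lcs_trans _ _ _ _ (s n.+1)).
    exact: lcsW.
  by rewrite sS; apply: lcsW; apply: component_lcs.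
have [c _ Ec] := surj _ invlim_s; exists c => n; exists n => N le_nN.
have : lcs_coset n c (s n).
  by rewrite (congr1 (fun F => F n) Ec) /lcs_coset /= subrr; apply: lcs0.
rewrite /lcs_coset /=; apply: lcs_trans.
rewrite -/(s N) -(subnK le_nN); elim: (N - n)%N => [|k IH].
  by rewrite subrr; apply: lcs0.
apply: lcs_trans IH; rewrite addSn sS.
by apply: lcs_leq (component_lcs _); rewrite -addSn leq_addl.
Qed.
End Components.

Lemma represents_comp (T T' : finType) (ev : T' -> L) (u : T -> L) f g h c :
    represents u f c -> (forall b, represents ev (g b) (u b)) ->
    (forall n, eqm n h (nc_subst n g f)) ->
  represents ev h c.
Proof.
move=> fc gu hfg n; have [p [pf pc]] := fc n.
have /choice[s sP] : forall b, exists q,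
    eqm n (lie_poly_ncs q) (g b) /\ lcs n (lie_poly_eval ev q - u b).
  by move=> b; apply: gu.
exists (lie_subst s p); split.
  apply: eqm_trans (lie_subst_nc _ _) _; apply: eqm_trans (eqm_sym (hfg n)).
  rewrite (nc_subst_eqm _ pf); apply: nc_subst_cong => b; exact: (sP b).1.
rewrite lie_subst_eval; apply: lcs_trans pc; apply: lie_poly_eval_lcs => b.
exact: (sP b).2.
Qed.
End Represent.

(** * Baker-Campbell-Hausdorff products *)

Section Relabel.
Variables (T T' : finType) (h : T -> T') (h' : T' -> T).
Hypotheses (hK : cancel h h') (h'K : cancel h' h).

(** Pulling back along h' sends the letter x to h x. *)
Definition relabel (f : ncs T) : ncs T' := fun w => f (map h' w).

Lemma relabelM f g : relabel (f * g) = relabel f * relabel g.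
Proof.
apply/funext => w; rewrite /relabel !ncs_mulE size_map.
by apply: eq_bigr => i _; rewrite map_take map_drop.
Qed.

Lemma relabel_nexp f : relabel (nexp f) = nexp (relabel f).
Proof.
apply/funext => w; rewrite /relabel /nexp /ncexp size_map.
apply: eq_bigr => i _; congr (_ / _); rewrite !ncpowE -/(relabel (f ^+ i) w).
congr (_ w); elim: (nat_of_ord i) => [|n IH]; first by apply/funext => -[].
by rewrite !exprS relabelM IH.
Qed.

Lemma relabel_var x : relabel (nX x) = nX (h x).
Proof.
apply/funext => w; rewrite /relabel /nX /ncX.
by rewrite -(inj_eq (inj_map (can_inj h'K)) w [:: h x]) /= hK.
Qed.

Lemma relabel_lie p :
  lie_poly_ncs (lie_subst (fun x => LieVar (h x)) p) = relabel (lie_poly_ncs p).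
Proof.
elim: p => [x||p IHp q IHq|c p IHp|p IHp q IHq].
- exact: (esym (relabel_var x)).
- by [].
- rewrite [LHS](_ : _ = relabel (lie_poly_ncs p) + relabel (lie_poly_ncs q)) //.
  by rewrite -IHp -IHq.
- by rewrite [LHS](_ : _ = c *: relabel (lie_poly_ncs p)) // -IHp.
rewrite lie_poly_ncs_bracket /adr [RHS](_ : _ = relabel (lie_poly_ncs p * lie_poly_ncs q)
  - relabel (lie_poly_ncs q * lie_poly_ncs p)) //.
by rewrite !relabelM -IHp -IHq.
Qed.
End Relabel.

(** * Reversal of words and its sign on Lie polynomials *)

Section Reversal.
Variable T : finType.
Implicit Types f g : ncs T.

Definition nc_rev f : ncs T := fun w => f (rev w).

Lemma nc_revM f g : nc_rev (f * g) = nc_rev g * nc_rev f.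
Proof.
apply/funext => w; rewrite /nc_rev !ncs_mulE size_rev (reindex_inj rev_ord_inj) /=.
apply: eq_bigr => i _; have le_iw : (i <= size w)%N by rewrite -ltnS.
by rewrite subSS take_rev drop_rev subKn // mulrC.
Qed.

Lemma nc_rev1 : nc_rev 1 = 1.
Proof.
apply/funext => w; rewrite /nc_rev -[RHS]/((w == [::])%:R) -[LHS]/((rev w == [::])%:R).
by rewrite -!size_eq0 size_rev.
Qed.

Lemma nc_rev_var x : nc_rev (nX x) = nX x.
Proof.
apply/funext => w; rewrite /nc_rev /nX /ncX.
by rewrite -(inj_eq (can_inj revK)) revK.
Qed.

Lemma nc_rev_nexp f : nc_rev (nexp f) = nexp (nc_rev f).
Proof.
apply/funext => w; rewrite /nc_rev /nexp /ncexp size_rev.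
apply: eq_bigr => i _; congr (_ / _); rewrite !ncpowE -/(nc_rev (f ^+ i) w).
congr (_ w); elim: (nat_of_ord i) => [|n IH]; first exact: nc_rev1.
by rewrite exprS nc_revM IH exprSr.
Qed.

Lemma nc_rev_prod (s : seq T) (F : T -> ncs T) :
  nc_rev (\prod_(x <- s) F x) = \prod_(x <- rev s) nc_rev (F x).
Proof.
elim: s => [|x s IH]; first by rewrite !big_nil nc_rev1.
by rewrite big_cons nc_revM IH rev_cons -cats1 big_cat /= big_seq1.
Qed.

(** Reversal is an antiautomorphism fixing the letters, so each bracket costs a sign. The exponent n
    + 1 has the parity of n - 1 and avoids truncated subtraction at the empty word. *)
Lemma nc_rev_lie (p : lie_poly T) w :
  lie_poly_ncs p (rev w) = (-1) ^+ (size w).+1 * lie_poly_ncs p w.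
Proof.
elim: p w => [x||p IHp q IHq|c p IHp|p IHp q IHq] w.
- rewrite -[LHS]/(nc_rev (nX x) w) nc_rev_var /lie_poly_ncs /= /nX /ncX.
  by case: eqP => [->|_]; rewrite ?mulr0 //= sqrrN !expr1n mulr1.
- by rewrite mulr0.
- by rewrite [LHS]/= [X in _ * X]/= mulrDr -IHp -IHq.
- by rewrite [LHS]/= [X in _ * X]/= mulrCA -IHp.
have revM f g : (forall v, f (rev v) = (-1) ^+ (size v).+1 * f v) ->
    (forall v, g (rev v) = (-1) ^+ (size v).+1 * g v) ->
    (f * g) (rev w) = (-1) ^+ size w * (g * f) w.
  move=> Ef Eg; rewrite -/(nc_rev (f * g) w) nc_revM !ncs_mulE mulr_sumr.
  apply: eq_bigr => i _; have le_iw : (i <= size w)%N by rewrite -ltnS.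
  rewrite /nc_rev Ef Eg mulrACA -exprD size_takel // size_drop addSn addnS subnKC //.
  by rewrite !exprS !mulN1r opprK.
rewrite lie_poly_ncs_bracket /adr !ncs_subE !revM // -mulrBr exprS mulN1r mulNr.
by rewrite -mulrN opprB.
Qed.

Lemma reversed_components P f : homogeneous_components P f ->
  homogeneous_components (fun n => LieScale ((-1) ^+ n.-1) (P n)) (nc_rev f).
Proof.
move=> Pf n w; rewrite -[LHS]/((-1) ^+ n.-1 * lie_poly_ncs (P n) w).
have := Pf n (rev w); rewrite nc_rev_lie size_rev /nc_rev => <-.
have := Pf n w; case: eqP => [<- _|_ ->]; last by rewrite !mulr0.
case: w => [|c w] /=; first by rewrite lie_poly_ncs_nil !mulr0.
by rewrite !exprS !mulN1r opprK.
Qed.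
End Reversal.

Section TreePolynomials.
Variable k : nat.

Fixpoint tree_poly (T : Type) (t : ltree T) : lie_poly T :=
  match t with
  | Leaf a => LieVar a
  | Node l r => LieBracket (tree_poly l) (tree_poly r)
  end.

Definition tree_sum_poly (n : nat) : lie_poly 'I_k :=
  foldr (fun t p => LieAdd (LieScale (tree_coef t) (tree_poly t)) p)
        (LieZero _) (posetted_trees 'I_k n).

Lemma tree_poly_nc (t : ltree 'I_k) : lie_poly_ncs (tree_poly t) = tree_nc t.
Proof. by elim: t => //= l <- r <-. Qed.

Lemma tree_sum_poly_eval (K : fieldType) (L : lieAlgType K) (ev : 'I_k -> L) n :
  lie_poly_eval ev (tree_sum_poly n) = tree_sum ev n.
Proof.
rewrite /tree_sum /tree_sum_poly.
elim: (posetted_trees _ _) => [|t s IH] /=; first by rewrite big_nil.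
rewrite big_cons IH; congr (_ *: _ + _).
by elim: t {s IH} => //= l -> r ->.
Qed.

Lemma tree_sum_components : homogeneous_components tree_sum_poly (chain_series k).
Proof.
move=> n w; have -> : lie_poly_ncs (tree_sum_poly n) w =
    \sum_(t <- ltrees 'I_k n) chain_coef k t * tree_nc t w.
  transitivity (\sum_(t <- posetted_trees 'I_k n) tree_coef t * tree_nc t w).
    rewrite /tree_sum_poly; elim: (posetted_trees _ _) => [|t s IH]; first by rewrite big_nil.
    by rewrite big_cons -IH -tree_poly_nc.
  rewrite big_filter big_mkcond; apply: eq_bigr => t _.
  by rewrite chain_coef_posetted; case: ifP; rewrite ?mul0r.
case: eqP => [<- //|/eqP neq_wn]; rewrite big1_seq // => t.
by rewrite mem_ltrees => /andP[_ /eqP szt]; rewrite tree_nc_size ?mulr0 // szt.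
Qed.
End TreePolynomials.

Section BchProducts.
Variables (K : fieldType) (charK : [pchar K] =i pred0).
Variables (L : lieAlgType K) (completeL : lie_complete L).

(** The larger label 1 becomes X = [false] and the smaller label 0 becomes Y = [true], because the
    exponential of the chain series has the larger letter on the left. *)
Let letter (i : 'I_2) : bool := val i == 0%N.
Let index (b : bool) : 'I_2 := if b then ord0 else ord_max.

Lemma letterK : cancel letter index.
Proof. by move=> i; apply: val_inj; case: i => [[|[|]]]. Qed.

Lemma indexK : cancel index letter.
Proof. by case. Qed.

Let bchs : ncs bool := bch_series.

Lemma nexp_relabel_chain :
  nexp (relabel index (chain_series 2)) = nexp (nX false) * nexp (nX true).
Proof.
rewrite -relabel_nexp nexp_chain enum_ordSl enum_ordSl enum_ord0 /=.
rewrite /rev /= !big_cons big_nil mulr1 relabelM !relabel_nexp.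
by rewrite !(relabel_var letterK indexK).
Qed.

Lemma bch_seriesE : bchs = relabel index (chain_series 2).
Proof.
rewrite -[RHS]nlog_nexp; last exact: tree_series_nil.
by rewrite nexp_relabel_chain.
Qed.

Lemma nexp_bchs : nexp bchs = nexp (nX false) * nexp (nX true).
Proof. by rewrite bch_seriesE nexp_relabel_chain. Qed.

Lemma bch_components : homogeneous_components
  (fun n => lie_subst (fun i => LieVar (letter i)) (tree_sum_poly 2 n)) bchs.
Proof.
move=> n w; rewrite (relabel_lie letterK indexK) bch_seriesE /relabel.
by rewrite tree_sum_components size_map.
Qed.

(** Convergence of the tree series shows that [xget] does not return its default. The polynomials
    witnessing [is_bch] may be others than the trees, which [represents_series] allows. *)
Lemma bch_represents (a b : L) :
  represents (fun i : bool => if i then b else a) bchs (bch a b).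
Proof.
have [c cser] := series_converges charK (fun i : bool => if i then b else a)
  bch_components completeL.
have : is_bch a b (bch a b).
  apply: xgetPex; exists c.
  exists (fun n => lie_subst (fun i => LieVar (letter i)) (tree_sum_poly 2 n)).
  by split => //; apply: bch_components.
by case=> P [PE ser]; apply/(represents_series charK _ PE).
Qed.

Lemma represents_bch (T : finType) (ev : T -> L) f g u v :
    represents ev f u -> represents ev g v ->
  exists F, represents ev F (bch u v) /\ nexp F = nexp f * nexp g.
Proof.
move=> fu gv; have f0 := represents_nil fu; have g0 := represents_nil gv.
pose phi (i : bool) := if i then g else f.
have phi0 c : eqm 1 (phi c) 0 by apply: eqm1; case: c.
(* Truncation at order [(size w).+1] is already stable at w, so F is the full substitution of f and
   g in the Baker-Campbell-Hausdorff series. *)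
pose F : ncs T := fun w => nc_subst (size w).+1 phi bchs w.
have EF n : eqm n F (nc_subst n phi bchs).
  by move=> w ltw; apply: (nc_subst_leq phi0 bchs ltw).
exists F; split.
  by apply: (represents_comp (bch_represents u v) _ EF) => -[].
have bch0 : bchs [::] = 0 by exact: represents_nil (bch_represents 0 0).
have F0 : F [::] = 0 by apply: nc_subst_nil.
apply: eqmP => n; apply: eqm_trans (eqm_nexp F0 (nc_subst_nil phi0 n bch0) (EF n)) _.
apply: eqm_trans (eqm_sym (nc_subst_exp phi0 bch0)) _; rewrite nexp_bchs.
apply: eqm_trans (nc_substM phi0 _ _) _.
by apply: eqmM; apply: eqm_trans (nc_subst_exp phi0 _) _ => //; apply: eqm_nexp => //;
  rewrite ?nc_subst_nil //; apply: nc_subst_var.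
Qed.

Lemma bch_prod_represents (T : finType) (ev : T -> L) x s :
  exists F, represents ev F (bch_prod (map ev (x :: s))) /\
            nexp F = \prod_(i <- x :: s) nexp (nX i).
Proof.
rewrite big_cons /=; have := represents_var ev x.
elim: s (ev x) (nX x) => [|y s IH] u f fu /=.
  by exists f; rewrite big_nil mulr1.
have [g [gu Eg]] := represents_bch fu (represents_var ev y).
have [F [Fu EF]] := IH _ _ gu.
by exists F; split=> //; rewrite EF Eg big_cons mulrA.
Qed.

(** Injectivity of exp identifies f with the series produced by iterating [represents_bch], whatever
    the origin of f. *)
Lemma bch_prod_series (T : finType) (ev : T -> L) (s : seq T) P f :
    s != [::] -> homogeneous_components P f ->
    nexp f = \prod_(i <- s) nexp (nX i) ->
  lie_series (fun n => lie_poly_eval ev (P n)) (bch_prod (map ev s)).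
Proof.
case: s => // x s _ Pf Ef; have [F [Fu EF]] := bch_prod_represents ev x s.
apply/(represents_series charK ev Pf); rewrite (_ : f = F) //.
apply: nexp_inj; [|exact: represents_nil Fu|by rewrite Ef EF].
by have := Pf 0%N [::]; rewrite lie_poly_ncs_nil.
Qed.
End BchProducts.

Lemma ratr_sign (K : fieldType) n : ratr ((-1) ^+ n) = (-1) ^+ n :> K.
Proof.
have -> : (-1) ^+ n = ((-1) ^+ n : int)%:~R :> rat by rewrite rmorphXn /= mulrN1z.
by rewrite ratr_int rmorphXn /= mulrN1z.
Qed.

Theorem theorem11 (K : fieldType) (charK : [pchar K] =i pred0)
    (L : lieAlgType K) (completeL : lie_complete L) :
  (forall (k : nat) (a : 'I_k -> L), (0 < k)%N ->
     lie_series (fun n => tree_sum a n)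
                (bch_prod (rev [seq a i | i <- enum 'I_k])) /\
     lie_series (fun n => (-1) ^+ n.-1 *: tree_sum a n)
                (bch_prod [seq a i | i <- enum 'I_k])) /\
  (forall a b : L,
     lie_series (fun n => tree_sum (fun i : 'I_2 => tnth [tuple b; a] i) n)
                (bch a b)).
Proof.
have main (k : nat) (a : 'I_k -> L) : (0 < k)%N ->
     lie_series (fun n => tree_sum a n)
                (bch_prod (rev [seq a i | i <- enum 'I_k])) /\
     lie_series (fun n => (-1) ^+ n.-1 *: tree_sum a n)
                (bch_prod [seq a i | i <- enum 'I_k]).
  move=> k_gt0; have nz : enum 'I_k != [::] by rewrite -size_eq0 size_enum_ord -lt0n.
  split.
    under eq_fun do rewrite -tree_sum_poly_eval; rewrite -map_rev.
    apply: (bch_prod_series charK completeL a _ (@tree_sum_components k)).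
      by rewrite -size_eq0 size_rev size_eq0.
    exact: nexp_chain.
  under eq_fun do rewrite -tree_sum_poly_eval -ratr_sign.
  apply: (bch_prod_series charK completeL a nz (reversed_components (@tree_sum_components k))).
  (* Reversing words restores the increasing order of the exponentials, and each e^(a_i) is
     fixed. *)
  rewrite -nc_rev_nexp nexp_chain nc_rev_prod revK; apply: eq_bigr => i _.
  by rewrite nc_rev_nexp nc_rev_var.
(* Label 0 stands for b and label 1 for a, so the reversed enumeration is a, b. *)
split=> // a b; have [] := main 2%N (fun i => tnth [tuple b; a] i) isT.
by rewrite enum_ordSl enum_ordSl enum_ord0.
Qed.
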